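(* Let $c_1=\big(\frac{e^2}{2\sqrt\pi}\big)^{1/2}$. There exist absolute constants $c_2,c_3,c_4>0$ such that: (i) for all $n,k\in\mathbb{N}$ with $n\ge k+2$, $$\tau_{n,k}\le c_1\Big(\frac{2}{e}\Big)^k\frac{k^{1/4}}{(1-\frac{k^2}{n^2})^{k/2}},$$ and in particular $\tau_{n,k}<c_2\big(\frac2e\big)^k k^{1/4}$ whenever $n\ge k+2$ and $n\ge k^{3/2}$; (ii) for all $m\ge 2$ and $n\ge m+1$ (so that $k=n-m\ge1$), $$\tau_{n,n-m}\le c_3\,m^{1/4}\Big(\frac{me}{2}\Big)^{m/2}n^{-m/2};$$ (iii) for every $\lambda\in(0,1)$ there is $\rho_\lambda<1$ such that, with $k=\lfloor\lambda n\rfloor$ (whenever $k\ge1$ and $n\ge k+2$), $\tau_{n,k}\le c_4\,n^{1/4}\rho_\lambda^{n/2}$; in particular, for even $n\ge 4$, $$\tau_{n,n/2}<c_1\,n^{1/4}\Big(\frac{4}{\sqrt{27}}\Big)^{n/2}.$$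
   Context: $T_n$ denotes the Chebyshev polynomial of the first kind of degree $n$, $T_n(\cos\theta)=\cos n\theta$. For integers $n\ge k+2$, $k\ge 1$, let $\omega_{n,k}$ be the rightmost (largest) zero of $T_n^{(k+1)}$ and define $\tau_{n,k}:=|T_n^{(k)}(\omega_{n,k})|/T_n^{(k)}(1)$. *)

(* Defs.v *)
From HB Require Import structures.
From mathcomp Require Import all_boot all_order all_algebra.
From mathcomp Require Import all_classical all_reals all_analysis.
Set Implicit Arguments. Unset Strict Implicit. Unset Printing Implicit Defensive.
Import Order.TTheory GRing.Theory Num.Theory.
Local Open Scope ring_scope.

Fixpoint cheb_pair (R : nzRingType) (n : nat) : {poly R} * {poly R} :=
  match n with
  | 0%N => (1, 'X)
  | n'.+1 => let p := cheb_pair R n' in (p.2, 2%:R *: 'X * p.2 - p.1)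
  end.

Definition chebT (R : nzRingType) (n : nat) : {poly R} := (cheb_pair R n).1.

Definition is_omega (R : realType) (n k : nat) (w : R) : Prop :=
  root ((chebT R n)^`(k.+1)) w /\
  forall x : R, root ((chebT R n)^`(k.+1)) x -> x <= w.

(* tau_{n,k} computed at a given point w (intended: w = omega_{n,k}) *)
Definition tau_at (R : realType) (n k : nat) (w : R) : R :=
  `|((chebT R n)^`(k)).[w]| / ((chebT R n)^`(k)).[1].

Definition c1 (R : realType) : R := Num.sqrt (expR 1 ^+ 2 / (2 * Num.sqrt pi)).

(* Main.v *)
Require Import Defs.
From HB Require Import structures.
From mathcomp Require Import all_boot all_order all_algebra.
From mathcomp Require Import ring lra polyrcf.
From mathcomp Require Import all_classical all_reals all_analysis.
Set Implicit Arguments. Unset Strict Implicit. Unset Printing Implicit Defensive.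
Import Order.TTheory GRing.Theory Num.Theory.
Local Open Scope ring_scope.

(* Write s = 1 - x^2 and y_k = T_n^(k), so that
   s y_(k+2) = (2k+1) x y_(k+1) - (n^2-k^2) y_k.  Together with the derivatives z_k of
   sin(n arccos x), which obey the same recurrence, one has the Duffin-Schaeffer majorant
   y_k^2 <= y_k^2 + z_k^2 = D_k, and D_k is an explicit polynomial in 1/s with nonnegative
   coefficients.  A Sturm argument gives 1 - omega^2 >= k(k+1)/n^2; at such points the m-th term of
   D_k is at most the leading one times the Wallis ratio (2m)!/(4^m m!^2), and these ratios sum to
   2k (2k)!/(4^k k!^2) <= sqrt(2k).  Dividing by T_n^(k)(1) = n^2(n^2-1)...(n^2-(k-1)^2)/(2k-1)!!
   bounds tau^2 by

     (2k-1)!!^2 (2k (2k)!/(4^k k!^2)) (n^2/(k(k+1)))^k / (n^2(n^2-1)...(n^2-(k-1)^2)).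

   All parts are Stirling-type estimates of this quantity; (iii) combines (i) for 2k <= n with
   (ii) for 2k > n, using lam n/2 <= k <= lam n. *)

(** * The differential equation of Chebyshev polynomials *)

Lemma chebTSS (R : comNzRingType) (n : nat) :
  chebT R n.+2 = 2 * 'X * chebT R n.+1 - chebT R n.
Proof.
by rewrite {1}/chebT /= -scaler_nat; congr (_ * _ - _); rewrite -!mul_polyC mulr1 polyCMn.
Qed.

(** With x = cos t this is T_n' = n sin(nt) / sin t, the sines being eliminated by the addition
    formulas. The two identities need a joint induction: the first at n+1 is the second at n
    rewritten by the recurrence. *)
Lemma chebT_deriv (R : comNzRingType) (n : nat) :
  (1 - 'X^2) * (chebT R n)^`() = n%:R * ('X * chebT R n - chebT R n.+1) /\
  (1 - 'X^2) * (chebT R n.+1)^`() = n.+1%:R * (chebT R n - 'X * chebT R n.+1).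
Proof.
elim: n => [|n [IH0 IH1]].
  by rewrite /chebT /= derivC derivX; split; ring.
split; first by rewrite IH1 chebTSS; ring.
rewrite chebTSS derivB !derivM derivX derivMn derivC mul0rn.
have -> : (1 - 'X^2) * ((0 * 'X + 2 * 1) * chebT R n.+1
    + 2 * 'X * (chebT R n.+1)^`() - (chebT R n)^`()) =
  2 * (1 - 'X^2) * chebT R n.+1 + 2 * 'X * ((1 - 'X^2) * (chebT R n.+1)^`())
    - (1 - 'X^2) * (chebT R n)^`() by ring.
by rewrite IH0 IH1; ring.
Qed.

(** The quadratic form a^2 - 2xab + b^2 is invariant under (a, b) -> (b, 2xb - a), so its value at n
    = 0 persists. *)
Lemma chebT_pythagoras (R : comNzRingType) (n : nat) :
  chebT R n ^+ 2 - 2 * 'X * chebT R n * chebT R n.+1 + chebT R n.+1 ^+ 2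
  = 1 - 'X^2.
Proof.
elim: n => [|n IH]; first by rewrite /chebT /=; ring.
by rewrite -IH chebTSS; ring.
Qed.

Lemma oneBXsqr_neq0 (R : idomainType) : 1 - 'X^2 != 0 :> {poly R}.
Proof. by rewrite -opprB oppr_eq0 monic_neq0 // -polyC1 monicXnsubC. Qed.

(** This is cos^2 + sin^2 = 1 at the angle nt, scaled by n^2. *)
Lemma chebT_energy (R : idomainType) (n : nat) :
  (1 - 'X^2) * (chebT R n)^`() ^+ 2 + n%:R ^+ 2 * chebT R n ^+ 2
  = n%:R ^+ 2.
Proof.
apply: (mulfI (oneBXsqr_neq0 R)).
transitivity (((1 - 'X^2) * (chebT R n)^`()) ^+ 2
              + (1 - 'X^2) * (n%:R ^+ 2 * chebT R n ^+ 2)); first by ring.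
have [-> _] := chebT_deriv R n.
rewrite [RHS]mulrC -[X in _ = _ * X](chebT_pythagoras R n); ring.
Qed.

Lemma deriv_nat (R : nzRingType) (m : nat) : (m%:R : {poly R})^`() = 0.
Proof. by rewrite derivMn derivC mul0rn. Qed.

Lemma deriv_oneBXsqr (R : comNzRingType) : (1 - 'X^2)^`() = - (2 * 'X) :> {poly R}.
Proof. by rewrite derivB derivXn derivC; ring. Qed.

(** One differentiation sends (c, d) to (c + 2, d - c), which drives the induction of [chebT_ode].
    The constants are polynomials with zero derivative so as to match numerals of [{poly R}]. *)
Lemma gegenbauer_deriv (R : comNzRingType) (p c d : {poly R}) :
  c^`() = 0 -> d^`() = 0 ->
  (1 - 'X^2) * p^`()^`() = c * 'X * p^`() - d * p ->
  (1 - 'X^2) * p^`()^`()^`() = (c + 2) * 'X * p^`()^`() - (d - c) * p^`().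
Proof.
move=> c0 d0 /(congr1 (@deriv R)).
rewrite derivM deriv_oneBXsqr derivB !derivM c0 d0 derivX => E.
apply: (addrI (- (2 * 'X) * p^`()^`())).
by rewrite E; ring.
Qed.

Lemma chebT_ode (R : idomainType) (n k : nat) :
  (1 - 'X^2) * (chebT R n)^`(k.+2) =
  (2 * k%:R + 1) * 'X * (chebT R n)^`(k.+1)
  - (n%:R ^+ 2 - k%:R ^+ 2) * (chebT R n)^`(k).
Proof.
elim: k => [|k IH]; last first.
  have dc : (2 * k%:R + 1 : {poly R})^`() = 0.
    by rewrite derivD derivM !deriv_nat derivC; ring.
  have dd : (n%:R ^+ 2 - k%:R ^+ 2 : {poly R})^`() = 0.
    by rewrite derivB !expr2 !derivM !deriv_nat; ring.
  by rewrite !derivnS in IH *; rewrite (gegenbauer_deriv dc dd IH); ring.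
have [E0 E1] := chebT_deriv R n.
rewrite derivn0 derivn1 derivnS derivn1.
have := congr1 (@deriv R) E0.
rewrite derivM deriv_oneBXsqr [in RHS]derivM derivB derivM deriv_nat derivX => E.
(* [chebT_deriv] only knows first derivatives multiplied by 1 - X^2, so the case k = 0 is proved
   after one more such multiplication. *)
apply: (mulfI (oneBXsqr_neq0 R)).
have {}E : (1 - 'X^2) * (chebT R n)^`()^`()
    = n%:R * (chebT R n + 'X * (chebT R n)^`() - (chebT R n.+1)^`())
      + 2 * 'X * (chebT R n)^`().
  by apply: (addrI (- (2 * 'X) * (chebT R n)^`())); rewrite E; ring.
transitivity (n%:R * ((1 - 'X^2) * chebT R n + 'X * ((1 - 'X^2) * (chebT R n)^`())
   - (1 - 'X^2) * (chebT R n.+1)^`()) + 2 * 'X * ((1 - 'X^2) * (chebT R n)^`())).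
  by rewrite E; ring.
transitivity ('X * ((1 - 'X^2) * (chebT R n)^`())
   - (1 - 'X^2) * (n%:R ^+ 2 * chebT R n)); last by ring.
by rewrite E0 E1; ring.
Qed.

Lemma horner_nat (R : nzRingType) (m : nat) (x : R) : (m%:R : {poly R}).[x] = m%:R.
Proof. by rewrite hornerMn hornerC. Qed.

Lemma chebT_ode_at (R : idomainType) (n k : nat) (x : R) :
  (1 - x ^+ 2) * (chebT R n)^`(k.+2).[x] =
  (2 * k%:R + 1) * x * (chebT R n)^`(k.+1).[x]
  - (n%:R ^+ 2 - k%:R ^+ 2) * (chebT R n)^`(k).[x].
Proof. by have /(congr1 (horner^~ x)) := chebT_ode R n k; rewrite !(hornerE, horner_nat). Qed.

Lemma chebT_energy_at (R : idomainType) (n : nat) (x : R) :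
  (1 - x ^+ 2) * (chebT R n)^`(1).[x] ^+ 2 + n%:R ^+ 2 * (chebT R n).[x] ^+ 2
  = n%:R ^+ 2.
Proof.
by have /(congr1 (horner^~ x)) := chebT_energy R n; rewrite derivn1 !(hornerE,
  horner_nat).
Qed.

(** * Values of the derivatives at 1, positivity and parity *)

Definition sqr_falling (R : pzRingType) (n k : nat) : R :=
  \prod_(j < k) (n%:R ^+ 2 - j%:R ^+ 2).

Definition odd_fact (R : pzSemiRingType) (k : nat) : R := \prod_(j < k) (2 * j%:R + 1).

Lemma sqr_fallingS (R : pzRingType) (n k : nat) :
  sqr_falling R n k.+1 = sqr_falling R n k * (n%:R ^+ 2 - k%:R ^+ 2).
Proof. exact: big_ord_recr. Qed.

Lemma odd_factS (R : pzSemiRingType) (k : nat) :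
  odd_fact R k.+1 = odd_fact R k * (2 * k%:R + 1).
Proof. exact: big_ord_recr. Qed.

Lemma chebT_at1 (R : comNzRingType) (n : nat) : (chebT R n).[1] = 1.
Proof.
suff [] : (chebT R n).[1] = 1 /\ (chebT R n.+1).[1] = 1 by [].
elim: n => [|n [IH0 IH1]]; first by rewrite /chebT /= !hornerE.
by split=> //; rewrite chebTSS -scaler_nat -!mul_polyC !hornerE IH0 IH1; ring.
Qed.

(** At x = 1 the leading coefficient of the differential equation vanishes, leaving a two-term
    recurrence in k. *)
Lemma chebT_derivn_at1 (R : idomainType) (n k : nat) :
  (chebT R n)^`(k).[1] * odd_fact R k = sqr_falling R n k.
Proof.
elim: k => [|k IH].
  by rewrite derivn0 chebT_at1 /odd_fact /sqr_falling !big_ord0 mulr1.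
have := chebT_ode_at n k (1 : R).
rewrite expr1n subrr mul0r mulr1 => /eqP; rewrite eq_sym subr_eq0 => /eqP E.
rewrite odd_factS sqr_fallingS -IH.
transitivity (odd_fact R k * ((2 * k%:R + 1) * (chebT R n)^`(k.+1).[1])); first by ring.
by rewrite E; ring.
Qed.

Section RealField.
Variable R : realFieldType.

Lemma ltr_sqr_nat (j n : nat) : (j < n)%N -> j%:R ^+ 2 < n%:R ^+ 2 :> R.
Proof. by move=> jn; rewrite -!natrX ltr_nat ltn_sqr. Qed.

Lemma sqr_falling_gt0 (n k : nat) : (k <= n)%N -> 0 < sqr_falling R n k.
Proof.
by move=> kn; apply: prodr_gt0 => j _; rewrite subr_gt0 ltr_sqr_nat // (leq_trans (ltn_ord j)).
Qed.

Lemma sqr_falling_ge0 (n k : nat) : 0 <= sqr_falling R n k.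
Proof.
have [/sqr_falling_gt0/ltW //|nk] := leqP k n.
by rewrite /sqr_falling (bigD1 (Ordinal nk)) //= subrr mul0r.
Qed.

Lemma odd_fact_gt0 (k : nat) : 0 < odd_fact R k.
Proof. by apply: prodr_gt0 => j _; rewrite ltr_wpDl // mulr_ge0. Qed.

Lemma chebT_derivn_at1E (n k : nat) :
  (chebT R n)^`(k).[1] = sqr_falling R n k / odd_fact R k.
Proof. by rewrite -chebT_derivn_at1 mulfK // gt_eqF // odd_fact_gt0. Qed.

(** In the Taylor expansion at 1 all coefficients are nonnegative, and the constant one is positive
    because k <= n. *)
Lemma chebT_derivn_gt0 (n k : nat) (x : R) :
  (k <= n)%N -> 1 <= x -> 0 < (chebT R n)^`(k).[x].
Proof.
move=> kn x1.
have h0 : 0 < (chebT R n)^`(k).[1].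
  by rewrite chebT_derivn_at1E divr_gt0 ?odd_fact_gt0 ?sqr_falling_gt0.
have -> : x = 1 + (x - 1) by rewrite addrC subrK.
rewrite nderiv_taylor; last exact: mulrC.
have /lt0n_neq0 : (0 < size ((chebT R n)^`(k)))%N.
  by rewrite lt0n size_poly_eq0; apply: contraTneq h0 => ->; rewrite horner0 ltxx.
case: (size _) => // m _; rewrite big_ord_recl expr0 mulr1 ltr_pwDl //.
  by rewrite nderivn0.
apply: sumr_ge0 => i _; rewrite mulr_ge0 ?exprn_ge0 ?subr_ge0 //.
have := congr1 (horner^~ 1) (nderivn_def (lift ord0 i) (chebT R n)^`(k)).
rewrite /derivn -iterD -/(derivn _ _) hornerMn => /(congr1 (fun z => 0 <= z)).
rewrite pmulrn_lge0 ?fact_gt0 // => <-.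
by rewrite chebT_derivn_at1E divr_ge0 ?sqr_falling_ge0 // ltW ?odd_fact_gt0.
Qed.

Lemma chebT_comp_oppX (n : nat) : chebT R n \Po (- 'X) = (-1) ^+ n *: chebT R n.
Proof.
suff [] : chebT R n \Po (- 'X) = (-1) ^+ n *: chebT R n /\
  chebT R n.+1 \Po (- 'X) = (-1) ^+ n.+1 *: chebT R n.+1 by [].
elim: n => [|n [IH0 IH1]].
  by rewrite /chebT /= comp_polyC comp_polyX expr0 scale1r expr1 scaleN1r.
split=> //; rewrite chebTSS comp_polyB !comp_polyM IH0 IH1 comp_polyX.
rewrite -mul_polyC -[2]/(2%:R) -polyCMn comp_polyC.
by rewrite -!mul_polyC !polyCMn !exprS !polyCM !polyCN polyC1; ring.
Qed.

Lemma chebT_derivn_opp (n k : nat) (x : R) :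
  (chebT R n)^`(k).[- x] = (-1) ^+ (n + k) * (chebT R n)^`(k).[x].
Proof.
suff H : (chebT R n)^`(k) \Po (- 'X) = (-1) ^+ (n + k) *: (chebT R n)^`(k).
  by have /(congr1 (horner^~ x)) := H; rewrite horner_comp !hornerE.
elim: k => [|k IH]; first by rewrite addn0 chebT_comp_oppX.
have := congr1 (@deriv R) IH.
rewrite deriv_comp derivN derivX derivZ -derivnS mulrN1 => /(congr1 (@GRing.opp _)).
by rewrite opprK addnS exprS mulN1r scaleNr.
Qed.
End RealField.

(** * The rightmost zero *)

(** A nonzero polynomial with a root in the interval has a largest one there, from which no ascent
    is possible. *)
Lemma no_ascending_roots (R : rcfType) (p : {poly R}) (a b c : R) :
  p != 0 -> c \in `]a, b[ -> root p c ->
  ~ (forall x, x \in `]a, b[ -> root p x -> exists2 y, y \in `]x, b[ & root p y).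
Proof.
move=> p0 cab pc asc; case: (prev_rootP p a b) => [/eqP|x _ /eqP px xab nr|_ _ _ nr].
- exact/negP.
- by have [y yx py] := asc _ xab px; have := nr y yx; rewrite py.
- by have := nr c cab; rewrite pc.
Qed.

Section Omega.
Variables (R : rcfType) (n k : nat).
Let s : {poly R} := 1 - 'X^2.
Let y : {poly R} := (chebT R n)^`(k.+1).
Let p : {poly R} := k.+1%:R * 'X * y - s * y^`().

(** With x = cos t and z = (sin t)^(k+1) y(cos t), s^(k+1) y^2 is z^2 and s^k p^2 is (dz/dt)^2;
    squaring avoids half-integer powers of s. *)
Lemma deriv_weight_sqr :
  (s ^+ k.+1 * y ^+ 2)^`() = - (2 * s ^+ k * y * p).
Proof.
rewrite derivM !deriv_exp deriv_oneBXsqr /p [s ^+ k.+1]exprS expr1; ring.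
Qed.

(** This is (z'^2)' = 2 z' z'' with z'' = (k(k+1)/s - n^2) z, written in the variable x. The middle
    factor carries the sign that decides the Sturm argument. *)
Lemma deriv_weight_sqrp : (0 < k)%N ->
  (s ^+ k * p ^+ 2)^`()
  = 2 * s ^+ k.-1 * p * (n%:R ^+ 2 * s - k%:R * (k%:R + 1)) * y.
Proof.
move=> k0; have -> : s ^+ k = s * s ^+ k.-1 by rewrite -exprS prednK.
have ode : s * y^`()^`() = (2 * k.+1%:R + 1) * 'X * y^`() - (n%:R ^+ 2 - k.+1%:R ^+ 2) * y.
  by rewrite -!derivnS chebT_ode.
have dp : s * p^`() = (n%:R ^+ 2 * s - k%:R * (k%:R + 1)) * y + k%:R * 'X * p.
  rewrite /p derivB !derivM deriv_nat derivX deriv_oneBXsqr.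
  transitivity (k.+1%:R * s * y + k.+1%:R * 'X * s * y^`() + 2 * 'X * (s * y^`())
     - s * (s * y^`()^`())); first by ring.
  by rewrite ode /s; ring.
rewrite derivM [(s * _)^`()]derivM !deriv_exp deriv_oneBXsqr expr1 /=.
have ds : s * ((k.-1)%:R * (- (2 * 'X) * s ^+ k.-1.-1)) = (k.-1)%:R * (- (2 * 'X)) * s ^+ k.-1.
  by case: k => [|[|j]] /=; rewrite ?mul0r ?mulr0 // exprS; ring.
transitivity ((- (2 * 'X) * s ^+ k.-1 + s * ((k.-1)%:R * (- (2 * 'X) * s ^+ k.-1.-1))) * p ^+ 2
  + s ^+ k.-1 * (2 * p * (s * p^`()))); first by ring.
rewrite ds dp.
have -> : k%:R = k.-1%:R + 1 :> {poly R} by rewrite natr1 prednK.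
ring.
Qed.

(* In the variable t = arccos x the function z = (sin t)^(k+1) y(cos t) solves
   z'' = (k(k+1)/(sin t)^2 - n^2) z, and z' = (sin t)^k p(cos t).  If the right-hand factor were
   positive up to the first zero of z, Rolle would give p an infinite ascending chain of roots. *)
Lemma omega_weight (w : R) : (0 < k)%N -> (k < n)%N -> 0 <= w < 1 -> root y w ->
  (forall x, root y x -> x <= w) ->
  k%:R * (k%:R + 1) <= n%:R ^+ 2 * (1 - w ^+ 2).
Proof.
move=> k0 kn /andP[w0 w1] yw wmax; rewrite leNgt; apply/negP => small.
have y_neq0 x : w < x -> y.[x] != 0.
  by move=> wx; apply/negP => /wmax; rewrite leNgt wx.
have s_gt0 x : w < x < 1 -> 0 < s.[x].
  by move=> /andP[wx x1]; rewrite /s !hornerE; nra.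
have s1 : s.[1] = 0 by rewrite /s !hornerE expr1n subrr.
have p0 : p != 0.
  apply/eqP => /(congr1 (horner^~ 1)); rewrite /p /s !(hornerE, horner_nat) => /eqP.
  by rewrite expr1n subrr mul0r subr0 mulf_eq0 pnatr_eq0 /= (negPf (y_neq0 _ w1)).
(* Rolle for z^2, which vanishes at w through y and at 1 through s, starts the chain of roots of
   p. *)
have [c cI pc] : exists2 c, c \in `]w, 1[ & root p c.
  have [] := @poly_rolle R w 1 (s ^+ k.+1 * y ^+ 2) w1.
    by rewrite hornerM [RHS]hornerM !horner_exp (eqP yw) s1 !expr0n mulr0 mul0r.
  move=> c cI /eqP; rewrite deriv_weight_sqr hornerN oppr_eq0 !hornerM horner_exp horner_nat.
  move: cI; rewrite in_itv /= => /andP[wc c1].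
  rewrite !mulf_eq0 pnatr_eq0 (negPf (y_neq0 _ wc)) expf_eq0.
  rewrite [s.[c] == 0]gt_eqF ?s_gt0 ?wc // andbF /= => pc.
  by exists c; rewrite ?in_itv /= ?wc // /root.
(* From a root x of p, Rolle for s^k p^2 on [x, 1] yields a critical point d; every factor of the
   derivative other than p is nonzero at d, so d is the next root. *)
apply: (no_ascending_roots p0 cI pc) => x; rewrite in_itv /= => /andP[wx x1] /eqP px.
have [] := @poly_rolle R x 1 (s ^+ k * p ^+ 2) x1.
  by rewrite hornerM [RHS]hornerM !horner_exp px s1 !expr0n (gtn_eqF k0) mulr0 mul0r.
have factorE (q : {poly R}) (z : R) : (n%:R ^+ 2 * q - k%:R * (k%:R + 1)).[z]
    = n%:R ^+ 2 * q.[z] - k%:R * (k%:R + 1) by rewrite !(hornerE, horner_nat).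
move=> d dI /eqP; rewrite (deriv_weight_sqrp k0) !hornerM horner_exp horner_nat factorE.
move: (dI); rewrite in_itv /= => /andP[xd d1].
have wd : w < d by apply: lt_trans xd.
(* As w >= 0, s decreases to the right of w, so the assumed smallness at w persists at d. *)
have small' : n%:R ^+ 2 * s.[d] - k%:R * (k%:R + 1) < 0.
  rewrite subr_lt0 (le_lt_trans _ small) // ler_wpM2l ?sqr_ge0 // /s !hornerE.
  by rewrite lerD2l lerN2 ler_sqr ?nnegrE // ltW // (le_lt_trans w0).
rewrite !mulf_eq0 (negPf (y_neq0 _ wd)) orbF pnatr_eq0 expf_eq0.
rewrite [s.[d] == 0]gt_eqF ?s_gt0 ?wd // andbF (lt_eqF small') orbF /= => pd.
by exists d.
Qed.
End Omega.

(** By parity -w is also a zero, hence w >= 0; the derivatives are positive on [1, +oo), hence w <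
    1. *)
Lemma omega_bounds (R : realType) (n k : nat) (w : R) :
  (0 < k)%N -> (k < n)%N -> is_omega n k w ->
  0 <= w < 1 /\ k%:R * (k%:R + 1) <= n%:R ^+ 2 * (1 - w ^+ 2).
Proof.
move=> k0 kn [yw wmax].
have w01 : 0 <= w < 1.
  apply/andP; split.
    have /wmax : root (chebT R n)^`(k.+1) (- w).
      by rewrite /root chebT_derivn_opp mulf_eq0 orbC -/(root _ _) yw.
    by rewrite -subr_ge0 opprK; lra.
  by rewrite ltNge; apply/negP => /(chebT_derivn_gt0 kn); rewrite (eqP yw) ltxx.
by split=> //; apply: omega_weight.
Qed.

(** * The Duffin-Schaeffer majorant *)

Section Majorant.
Variable R : realFieldType.
Implicit Types (n k m : nat) (x u K : R).

(** The product of the 2m consecutive factors from K - m to K + m - 1. For m > 0 it vanishes at the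
    integers 0 <= K <= m, which truncates D_k. *)
Definition rising_falling K m : R := \prod_(i < m) ((K + i%:R) * (K - i%:R - 1)).

Lemma rising_fallingS K m :
  rising_falling K m.+1 = rising_falling K m * ((K + m%:R) * (K - m%:R - 1)).
Proof. exact: big_ord_recr. Qed.

Lemma rising_falling0 K : rising_falling K 0 = 1.
Proof. exact: big_ord0. Qed.

(** This and the next lemma express the products at K and K + 2 through the one at K + 1, giving the
    three coefficients in [maj_coef_recS] a common factor. *)
Lemma rising_falling_lower K m :
  rising_falling K m.+1 = (K - m%:R - 1) * (K - m%:R) * rising_falling (K + 1) m.
Proof.
elim: m => [|m IH]; first by rewrite rising_fallingS !rising_falling0; ring.
by rewrite rising_fallingS IH [in RHS]rising_fallingS; ring.
Qed.

Lemma rising_falling_upper K m :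
  rising_falling (K + 2) m.+1 = (K + m%:R + 1) * (K + m%:R + 2) * rising_falling (K + 1) m.
Proof.
elim: m => [|m IH]; first by rewrite rising_fallingS !rising_falling0; ring.
by rewrite rising_fallingS IH [in RHS]rising_fallingS; ring.
Qed.

Lemma rising_falling_shift K m :
  (K - m%:R) * rising_falling (K + 1) m = (K + m%:R) * rising_falling K m.
Proof.
case: m => [|m]; first by rewrite !rising_falling0; ring.
by rewrite [in RHS]rising_falling_lower rising_fallingS; ring.
Qed.

Lemma rising_falling_eq0 k m : (k <= m)%N -> (0 < m)%N -> rising_falling k%:R m = 0.
Proof.
case: k => [|k] km m0.
  by rewrite /rising_falling (bigD1 (Ordinal m0)) //= addr0 mul0r mul0r.
have z : k.+1%:R - k%:R - 1 = 0 :> R by rewrite -natr1; ring.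
by rewrite /rising_falling (bigD1 (Ordinal km)) //= z mulr0 mul0r.
Qed.

(** The factor of the coefficients of D_k that does not depend on k. A zero denominator occurs only
    for m >= n, outside the sum [maj]. *)
Definition pole_weight n m : R :=
  \prod_(i < m) ((2 * i%:R + 1) / (2 * (i%:R + 1) * (n%:R ^+ 2 - (i%:R + 1) ^+ 2))).

Lemma pole_weightS n m : (m.+1 < n)%N ->
  pole_weight n m * (2 * m%:R + 1)
  = pole_weight n m.+1 * (2 * (m%:R + 1) * (n%:R ^+ 2 - (m%:R + 1) ^+ 2)).
Proof.
move=> mn; rewrite [pole_weight n m.+1]big_ord_recr /= -/(pole_weight n m).
have m0 : m%:R + 1 != 0 :> R by rewrite natr1 pnatr_eq0.
have nm : n%:R ^+ 2 - (m%:R + 1) ^+ 2 != 0 :> R.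
  by rewrite natr1 gt_eqF // subr_gt0 ltr_sqr_nat.
by field; rewrite nm m0.
Qed.

(* the coefficient of (1 - x^2)^-(k+m) in D_k *)
Definition maj_coef n k m : R :=
  sqr_falling R n k * rising_falling k%:R m * pole_weight n m.

Lemma maj_coef_eq0 n k m : (k <= m)%N -> (0 < m)%N -> maj_coef n k m = 0.
Proof. by move=> km m0; rewrite /maj_coef rising_falling_eq0 // mulr0 mul0r. Qed.

Lemma maj_coef_shift n k m :
  (k%:R - m%:R) * maj_coef n k.+1 m
  = (n%:R ^+ 2 - k%:R ^+ 2) * (k%:R + m%:R) * maj_coef n k m.
Proof.
rewrite /maj_coef sqr_fallingS -(natr1 k).
transitivity (sqr_falling R n k * (n%:R ^+ 2 - k%:R ^+ 2) * pole_weight n m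
   * ((k%:R - m%:R) * rising_falling (k%:R + 1) m)); first by ring.
by rewrite rising_falling_shift; ring.
Qed.

(** This and the next lemma are [maj_rec] compared power by power in u: here the lowest power u^k,
    below the power u^(k+m+1). *)
Lemma maj_coef_rec0 n k :
  maj_coef n k.+2 0 = - (2 * k%:R + 1) * maj_coef n k.+1 0
    + (n%:R ^+ 2 - k%:R ^+ 2) ^+ 2 * maj_coef n k 0.
Proof.
by rewrite /maj_coef !sqr_fallingS !rising_falling0 -(natr1 k); ring.
Qed.

Lemma maj_coef_recS n k m : (m.+1 < n)%N ->
  maj_coef n k.+2 m.+1 = (2 * k%:R + 1) * (2 * m%:R + 1) * maj_coef n k.+1 m
    - (2 * k%:R + 1) * (2 * m%:R + 3) * maj_coef n k.+1 m.+1
    + (n%:R ^+ 2 - k%:R ^+ 2) ^+ 2 * maj_coef n k m.+1.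
Proof.
move=> mn; rewrite /maj_coef !sqr_fallingS.
have -> : k.+2%:R = k%:R + 2 :> R by rewrite -(natrD _ k 2) addn2.
rewrite -(natr1 k) rising_falling_upper (rising_falling_lower k%:R) rising_fallingS.
set f := rising_falling _ _; set Q := sqr_falling _ _ _.
transitivity ((2 * k%:R + 1) * (Q * (n%:R ^+ 2 - k%:R ^+ 2)) * f
    * (pole_weight n m * (2 * m%:R + 1))
  - (2 * k%:R + 1) * (2 * m%:R + 3) * (Q * (n%:R ^+ 2 - k%:R ^+ 2)
       * (f * ((k%:R + 1 + m%:R) * (k%:R + 1 - m%:R - 1))) * pole_weight n m.+1)
  + (n%:R ^+ 2 - k%:R ^+ 2) ^+ 2
      * (Q * ((k%:R - m%:R - 1) * (k%:R - m%:R) * f) * pole_weight n m.+1)).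
  by rewrite pole_weightS //; ring.
by ring.
Qed.

(** D_k as a polynomial in u = (1 - x^2)^-1. The range m < n is the same for all k; for 0 < k < n
    the terms with m >= k are zero. *)
Definition maj n u k : R := \sum_(m < n) maj_coef n k m * u ^+ (k + m).

(* x * maj_mixed is half the derivative of D_k with respect to x, for u = (1 - x^2)^-1 *)
Definition maj_mixed n u k : R :=
  \sum_(m < n) (k%:R + m%:R) * maj_coef n k m * u ^+ (k + m).+1.

(** What D_k must satisfy when the recurrence for y_(k+2) is multiplied by y_(k+1), likewise for z,
    and the sum is divided by x. *)
Lemma maj_mixed_rec n u s k : s * u = 1 ->
  s * maj_mixed n u k.+1
  = (2 * k%:R + 1) * maj n u k.+1 - (n%:R ^+ 2 - k%:R ^+ 2) * maj_mixed n u k.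
Proof.
move=> su; rewrite /maj_mixed /maj !mulr_sumr -sumrB; apply: eq_bigr => m _.
have E := maj_coef_shift n k m.
transitivity (s * u * ((k.+1%:R + m%:R) * maj_coef n k.+1 m * u ^+ (k + m).+1)).
  by rewrite addSn [u ^+ (k + m).+2]exprS; ring.
transitivity ((2 * k%:R + 1) * (maj_coef n k.+1 m * u ^+ (k + m).+1)
  - (n%:R ^+ 2 - k%:R ^+ 2) * (k%:R + m%:R) * maj_coef n k m * u ^+ (k + m).+1).
  by rewrite -E su -(natr1 k); ring.
by rewrite addSn; ring.
Qed.

(** What D_k must satisfy when the recurrences for y_(k+2) and z_(k+2) are squared and added, with
    x^2 = 1 - s. *)
Lemma maj_rec n u s k : s * u = 1 -> (k.+2 <= n)%N ->
  s ^+ 2 * maj n u k.+2 =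
    (2 * k%:R + 1) ^+ 2 * (1 - s) * maj n u k.+1
    - 2 * (2 * k%:R + 1) * (n%:R ^+ 2 - k%:R ^+ 2) * (1 - s) * maj_mixed n u k
    + (n%:R ^+ 2 - k%:R ^+ 2) ^+ 2 * maj n u k.
Proof.
move=> su kn.
have -> : s ^+ 2 * maj n u k.+2 = \sum_(m < n) maj_coef n k.+2 m * u ^+ (k + m).
  rewrite /maj mulr_sumr; apply: eq_bigr => m _.
  transitivity ((s * u) ^+ 2 * (maj_coef n k.+2 m * u ^+ (k + m))).
    by rewrite !addSn !exprS; ring.
  by rewrite su expr1n mul1r.
(* [maj_coef_shift] merges both sums into coefficients at k+1, and 1 - s turns each u^(j+1) into
   u^(j+1) - u^j. *)
have -> : (2 * k%:R + 1) ^+ 2 * (1 - s) * maj n u k.+1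
    - 2 * (2 * k%:R + 1) * (n%:R ^+ 2 - k%:R ^+ 2) * (1 - s) * maj_mixed n u k
  = \sum_(m < n) (2 * k%:R + 1) * (2 * m%:R + 1) * maj_coef n k.+1 m * u ^+ (k + m).+1
    - \sum_(m < n) (2 * k%:R + 1) * (2 * m%:R + 1) * maj_coef n k.+1 m * u ^+ (k + m).
  rewrite /maj /maj_mixed !mulr_sumr -!sumrB; apply: eq_bigr => m _.
  have E := maj_coef_shift n k m.
  transitivity ((1 - s) * (2 * k%:R + 1) * ((2 * k%:R + 1) * maj_coef n k.+1 m * u ^+ (k + m).+1
     - 2 * ((n%:R ^+ 2 - k%:R ^+ 2) * (k%:R + m%:R) * maj_coef n k m) * u ^+ (k + m).+1)).
    by rewrite addSn; ring.
  rewrite -E.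
  transitivity ((2 * k%:R + 1) * (2 * m%:R + 1) * maj_coef n k.+1 m
     * (u ^+ (k + m).+1 - s * u * u ^+ (k + m))); first by rewrite exprS; ring.
  by rewrite su; ring.
rewrite /maj mulr_sumr.
(* The top term of the sum with the raised exponent vanishes because k+1 <= n; without it the
   indices align after a shift by one. *)
case: n kn => // n kn; rewrite ltnS in kn.
rewrite [X in _ = X - _ + _]big_ord_recr /= maj_coef_eq0 ?(leq_trans _ kn) //.
rewrite mulr0 mul0r addr0 !big_ord_recl /= !addn0 maj_coef_rec0.
have -> : \sum_(i < n) maj_coef n.+1 k.+2 (bump 0 i) * u ^+ (k + bump 0 i) =
  \sum_(i < n) (2 * k%:R + 1) * (2 * i%:R + 1) * maj_coef n.+1 k.+1 i * u ^+ (k + i).+1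
  - \sum_(i < n) (2 * k%:R + 1) * (2 * (bump 0 i)%:R + 1) * maj_coef n.+1 k.+1 (bump 0 i)
      * u ^+ (k + bump 0 i)
  + \sum_(i < n) (n.+1%:R ^+ 2 - k%:R ^+ 2) ^+ 2
      * (maj_coef n.+1 k (bump 0 i) * u ^+ (k + bump 0 i)).
  rewrite -sumrB -big_split; apply: eq_bigr => i _ /=.
  have -> : bump 0 i = i.+1 by [].
  by rewrite maj_coef_recS ?ltnS // addnS -(natr1 i); ring.
by ring.
Qed.

(** Here [a] and [b] play y_k and z_k at one point. The induction carries both squared norms, at k
    and k+1, and the mixed product: these three quantities close under the recurrence. *)
Lemma sqr_le_maj n x (a b : nat -> R) :
  x ^+ 2 < 1 ->
  (forall k, (1 - x ^+ 2) * a k.+2 =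
     (2 * k%:R + 1) * x * a k.+1 - (n%:R ^+ 2 - k%:R ^+ 2) * a k) ->
  (forall k, (1 - x ^+ 2) * b k.+2 =
     (2 * k%:R + 1) * x * b k.+1 - (n%:R ^+ 2 - k%:R ^+ 2) * b k) ->
  a 0 ^+ 2 + b 0 ^+ 2 = 1 -> a 0 * a 1 + b 0 * b 1 = 0 ->
  (1 - x ^+ 2) * (a 1 ^+ 2 + b 1 ^+ 2) = n%:R ^+ 2 ->
  forall k, (k < n)%N -> a k ^+ 2 <= maj n (1 - x ^+ 2)^-1 k.
Proof.
move=> x1; set s := 1 - x ^+ 2 => ra rb h0 h01 h1.
have s0 : s != 0 by rewrite gt_eqF // subr_gt0.
have su : s * s^-1 = 1 by rewrite mulfV.
suff H k : (k < n)%N -> [/\ a k ^+ 2 + b k ^+ 2 = maj n s^-1 k,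
    a k * a k.+1 + b k * b k.+1 = x * maj_mixed n s^-1 k &
    a k.+1 ^+ 2 + b k.+1 ^+ 2 = maj n s^-1 k.+1].
  by move=> k /H[<- _ _]; rewrite lerDl sqr_ge0.
elim: k => [|k IH] kn.
  case: n kn h1 {ra rb} => // n _ h1; split.
  - rewrite h0 /maj big_ord_recl big1 ?addr0 => [|i _]; last first.
      by rewrite maj_coef_eq0 ?mul0r.
    by rewrite /maj_coef /sqr_falling /pole_weight !big_ord0 rising_falling0 expr0 !mulr1.
  - rewrite h01 /maj_mixed big_ord_recl big1 ?addr0 => [|i _]; last first.
      by rewrite maj_coef_eq0 ?mulr0 ?mul0r.
    by rewrite /= !mul0r mulr0.
  - apply: (mulfI s0); rewrite h1 /maj big_ord_recl big1 ?addr0 => [|i _]; last first.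
      by rewrite maj_coef_eq0 ?mul0r.
    rewrite /maj_coef /pole_weight big_ord0 rising_falling0 expr1 !mulr1 mulrC divfK //.
    by rewrite sqr_fallingS /sqr_falling big_ord0 expr0n /=; ring.
have [e0 e01 e1] := IH (ltnW kn).
split=> //.
  apply: (mulfI s0); rewrite mulrCA (maj_mixed_rec _ _ su) -e1.
  transitivity (a k.+1 * (s * a k.+2) + b k.+1 * (s * b k.+2)); first by ring.
  rewrite ra rb mulrBr -mulrA.
  transitivity ((2 * k%:R + 1) * x * (a k.+1 ^+ 2 + b k.+1 ^+ 2)
    - (n%:R ^+ 2 - k%:R ^+ 2) * (a k * a k.+1 + b k * b k.+1)); first by ring.
  by rewrite e01; ring.
apply: (mulfI (expf_neq0 2 s0)); rewrite (maj_rec su kn) -e0 -e1.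
transitivity ((s * a k.+2) ^+ 2 + (s * b k.+2) ^+ 2); first by ring.
rewrite ra rb.
transitivity ((2 * k%:R + 1) ^+ 2 * x ^+ 2 * (a k.+1 ^+ 2 + b k.+1 ^+ 2)
  - 2 * (2 * k%:R + 1) * (n%:R ^+ 2 - k%:R ^+ 2) * x * (a k * a k.+1 + b k * b k.+1)
  + (n%:R ^+ 2 - k%:R ^+ 2) ^+ 2 * (a k ^+ 2 + b k ^+ 2)); first by ring.
by rewrite e01 /s; ring.
Qed.

(** * Wallis ratios and the size of the majorant *)

Definition wallis m : R := \prod_(i < m) ((2 * i%:R + 1) / (2 * i%:R + 2)).

Lemma wallisS m : wallis m.+1 = wallis m * ((2 * m%:R + 1) / (2 * m%:R + 2)).
Proof. exact: big_ord_recr. Qed.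

Lemma wallis_ge0 m : 0 <= wallis m.
Proof. by apply: prodr_ge0 => i _; rewrite divr_ge0 ?addr_ge0 ?mulr_ge0. Qed.

Lemma sum_wallis k : \sum_(m < k) wallis m = 2 * k%:R * wallis k.
Proof.
elim: k => [|k IH]; first by rewrite big_ord0 mulr0 mul0r.
have k2 : 2 * k%:R + 2 != 0 :> R by rewrite gt_eqF // ltr_wpDl // mulr_ge0.
by rewrite big_ord_recr /= IH wallisS -(natr1 k); field.
Qed.

(** The left side decreases in k, since (2k+1)(2k+3) <= (2k+2)^2. *)
Lemma wallis_sqr_le k : wallis k ^+ 2 * (2 * k%:R + 1) <= 1.
Proof.
elim: k => [|k IH]; first by rewrite /wallis big_ord0 mulr0 add0r expr1n mulr1.
have k0 : 0 <= k%:R :> R by [].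
have k2 : 2 * k%:R + 2 != 0 :> R by rewrite gt_eqF // ltr_wpDl // mulr_ge0.
rewrite wallisS -(natr1 k) (le_trans _ IH) //.
have -> : (wallis k * ((2 * k%:R + 1) / (2 * k%:R + 2))) ^+ 2 * (2 * (k%:R + 1) + 1)
  = wallis k ^+ 2 * (2 * k%:R + 1) * ((2 * k%:R + 1) * (2 * k%:R + 3) / (2 * k%:R + 2) ^+ 2).
  by field.
apply: ler_piMr; first by rewrite mulr_ge0 ?sqr_ge0 // addr_ge0 ?mulr_ge0.
by rewrite ler_pdivrMr ?mul1r; [nra|rewrite exprn_gt0 // ltr_wpDl // mulr_ge0].
Qed.

Lemma maj_le n k u : (0 < k)%N -> (k < n)%N -> 0 <= u ->
  k%:R * (k%:R + 1) * u <= n%:R ^+ 2 ->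
  maj n u k <= sqr_falling R n k * u ^+ k * (2 * k%:R * wallis k).
Proof.
move=> k0 kn u0 uk.
have kn2 : k%:R ^+ 2 <= n%:R ^+ 2 :> R by rewrite ltW ?ltr_sqr_nat.
have term m : (m < k)%N -> rising_falling k%:R m * pole_weight n m * u ^+ m <= wallis m.
  move=> mk; rewrite /rising_falling /pole_weight /wallis -big_split /= -(card_ord m) -prodr_const.
  rewrite card_ord -big_split /=; apply: ler_prod => i _ /=.
  have ik : (i.+1 < k)%N by rewrite (leq_ltn_trans _ mk).
  have := ltr_sqr_nat R (ltn_trans ik kn); have := ltr_sqr_nat R ik.
  have : i.+1%:R <= k%:R :> R by rewrite ler_nat ltnW.
  rewrite -(natr1 i); set I : R := i%:R; set N : R := n%:R; set K : R := k%:R.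
  have I0 : 0 <= I by [].
  move=> IK IK2 IN2.
  have NI : 0 < N ^+ 2 - (I + 1) ^+ 2 by rewrite subr_gt0.
  have -> : (K + I) * (K - I - 1) * ((2 * I + 1) / (2 * (I + 1) * (N ^+ 2 - (I + 1) ^+ 2))) * u
     = (2 * I + 1) / (2 * I + 2) * ((K + I) * (K - I - 1) * u / (N ^+ 2 - (I + 1) ^+ 2)).
    by field; rewrite !gt_eqF //; lra.
  have f0 : 0 <= (2 * I + 1) / (2 * I + 2) by rewrite divr_ge0 //; lra.
  have g0 : 0 <= (K + I) * (K - I - 1) by rewrite mulr_ge0 //; lra.
  have K0 : 0 < K * (K + 1) by rewrite mulr_gt0 //; lra.
  (* After multiplication by K(K+1) and the bound K(K+1)u <= N^2, there remains K(K+1)(I+1)^2 <= (2K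
     + I^2 + I) N^2, which follows from I + 1 <= K < N. *)
  have g1 : (K + I) * (K - I - 1) * u <= N ^+ 2 - (I + 1) ^+ 2.
    rewrite -(ler_pM2l K0).
    have h1 : (K + I) * (K - I - 1) * (K * (K + 1) * u) <= (K + I) * (K - I - 1) * N ^+ 2.
      exact: ler_wpM2l.
    have h2 : (I + 1) ^+ 2 * K ^+ 2 <= (I + 1) ^+ 2 * N ^+ 2 by apply: ler_wpM2l => //; apply:
        sqr_ge0.
    have h3 : K * (I + 1) ^+ 2 <= K * N ^+ 2 by apply: ler_wpM2l => //; apply: ltW.
    have h4 : 0 <= I * N ^+ 2 by rewrite mulr_ge0 ?sqr_ge0.
    by nra.
  apply/andP; split; first (apply: mulr_ge0; [done|apply: divr_ge0; [exact: mulr_ge0|exact: ltW]]).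
  by apply: ler_piMr => //; rewrite ler_pdivrMr // mul1r.
rewrite /maj mulrAC -sum_wallis mulr_sumr (big_ord_widen n (fun m => sqr_falling R n k * wallis
    m)) ?(ltnW kn) //.
rewrite [X in _ <= X * _]big_mkcond /= mulr_suml; apply: ler_sum => m _.
have [mk|km] := ltnP m k; last by rewrite maj_coef_eq0 ?mul0r // (leq_trans k0).
rewrite exprD /maj_coef.
have -> : sqr_falling R n k * rising_falling k%:R m * pole_weight n m * (u ^+ k * u ^+ m)
 = sqr_falling R n k * (rising_falling k%:R m * pole_weight n m * u ^+ m) * u ^+ k by ring.
by rewrite ler_wpM2r ?exprn_ge0 // ler_wpM2l ?sqr_falling_ge0 // term.
Qed.
End Majorant.

(** It supplies the sequence z_k at a single point from its recurrence, so that no trigonometric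
    function is differentiated. *)
Lemma second_order_rec (T : Type) (f : nat -> T -> T -> T) (b0 b1 : T) :
  exists b : nat -> T, [/\ b 0 = b0, b 1 = b1 & forall k, b k.+2 = f k (b k) (b k.+1)].
Proof.
pose g := fix g k := if k is k'.+1 then ((g k').2, f k' (g k').1 (g k').2) else (b0, b1).
by exists (fun k => (g k).1).
Qed.

Lemma chebT_derivn_sqr_le (R : rcfType) (n k : nat) (x : R) :
  (k < n)%N -> x ^+ 2 < 1 ->
  (chebT R n)^`(k).[x] ^+ 2 <= maj n (1 - x ^+ 2)^-1 k.
Proof.
move=> kn x1; set s := 1 - x ^+ 2.
have s0 : 0 < s by rewrite subr_gt0.
have n0 : n%:R != 0 :> R by rewrite pnatr_eq0 -lt0n (leq_ltn_trans _ kn).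
pose a j := (chebT R n)^`(j).[x]; pose t := Num.sqrt s.
have t2 : t ^+ 2 = s by rewrite sqr_sqrtr // ltW.
have t0 : t != 0 by rewrite gt_eqF // sqrtr_gt0.
have en : s * a 1 ^+ 2 + n%:R ^+ 2 * a 0 ^+ 2 = n%:R ^+ 2 by apply: chebT_energy_at.
(* b k is, up to sign, the k-th derivative at x of sin (n arccos x) *)
have [b [b0 b1 bS]] := second_order_rec
  (fun k y z => ((2 * k%:R + 1) * x * z - (n%:R ^+ 2 - k%:R ^+ 2) * y) / s)
  (t * a 1 / n%:R) (- (n%:R * a 0 / t)).
apply: (@sqr_le_maj R n x a b) => // [j|j|||].
- exact: chebT_ode_at.
- by rewrite bS mulrC divfK // gt_eqF.
- rewrite b0; apply: (mulfI (expf_neq0 2 n0)); rewrite mulr1 -[RHS]en -t2.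
  by field.
- by rewrite b0 b1; field; rewrite t0.
- by rewrite b1 -/s -[RHS]en -t2; field.
Qed.

Lemma tau_sqr_le (R : realType) (n k : nat) (w : R) :
  (0 < k)%N -> (k < n)%N -> is_omega n k w ->
  tau_at n k w ^+ 2 <= odd_fact R k ^+ 2 * (2 * k%:R * wallis R k)
    * (n%:R ^+ 2 / (k%:R * (k%:R + 1))) ^+ k / sqr_falling R n k.
Proof.
move=> k0 kn om; have [/andP[w0 w1] ws] := omega_bounds k0 kn om.
have w2 : w ^+ 2 < 1 by rewrite expr_lt1.
have s0 : 0 < 1 - w ^+ 2 by rewrite subr_gt0.
have kr : 0 < k%:R :> R by rewrite ltr0n.
have kk : 0 < k%:R * (k%:R + 1) :> R by rewrite mulr_gt0 // addr_gt0.
have q0 := sqr_falling_gt0 R (ltnW kn); have o0 := odd_fact_gt0 R k.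
rewrite /tau_at chebT_derivn_at1E expr_div_n real_normK ?num_real //.
have u1 : (1 - w ^+ 2)^-1 <= n%:R ^+ 2 / (k%:R * (k%:R + 1)).
  by rewrite -[_^-1]mul1r ler_pdivrMr // mulrAC ler_pdivlMr // mul1r.
have u2 : k%:R * (k%:R + 1) * (1 - w ^+ 2)^-1 <= n%:R ^+ 2 by rewrite ler_pdivrMr.
have b1 := chebT_derivn_sqr_le kn w2.
have b2 := maj_le k0 kn (ltW (eqbRL (invr_gt0 _) s0)) u2.
have b3 : (1 - w ^+ 2)^-1 ^+ k <= (n%:R ^+ 2 / (k%:R * (k%:R + 1))) ^+ k.
  by rewrite lerXn2r ?nnegrE ?invr_ge0 ?(ltW s0) // divr_ge0 ?sqr_ge0 // ltW.
rewrite ler_pdivrMr ?exprn_gt0 ?divr_gt0 //.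
apply: le_trans b1 _; apply: le_trans b2 _.
have -> : odd_fact R k ^+ 2 * (2 * k%:R * wallis R k) * (n%:R ^+ 2 / (k%:R * (k%:R + 1))) ^+ k
    / sqr_falling R n k * (sqr_falling R n k / odd_fact R k) ^+ 2
  = sqr_falling R n k * (n%:R ^+ 2 / (k%:R * (k%:R + 1))) ^+ k * (2 * k%:R * wallis R k).
  by field; rewrite !gt_eqF // addr_gt0.
rewrite ler_wpM2r ?mulr_ge0 ?wallis_ge0 ?ler0n //.
by rewrite ler_wpM2l // ltW.
Qed.

(** * Elementary estimates *)

Section Numerics.
Variable R : realType.
Implicit Types (n k m : nat) (x y : R).
Local Notation e := (expR 1 : R).

(** For y < 1 this is y <= artanh y. The difference h vanishes at 0 and has derivative z (e^z -
    e^-z) >= 0. *)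
Lemma expR_atanh y : 0 <= y -> expR (2 * y) * (1 - y) <= 1 + y.
Proof.
rewrite le_eqVlt => /predU1P[<-|y0]; first by rewrite mulr0 expR0 subr0 addr0 mul1r.
pose h (z : R) := (1 + z) * expR (- z) - (1 - z) * expR z.
have dh (z : R) : is_derive z (1 : R) h (z * (expR z - expR (- z))).
  rewrite /h; apply: is_derive_eq.
  by rewrite /GRing.scale /=; ring.
have [|c] := MVT y0 (fun z _ => dh z).
  by apply: derivable_within_continuous => z _; case: (dh z).
rewrite in_itv /= => /andP[c0 _].
rewrite /h oppr0 !(addr0, subr0, mul1r, expR0) subrr subr0 => E.
have : 0 <= (1 + y) * expR (- y) - (1 - y) * expR y.
  rewrite E !mulr_ge0 ?(ltW c0) ?(ltW y0) // subr_ge0 ler_expR; lra.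
rewrite subr_ge0 => /(ler_wpM2r (expR_ge0 y)).
rewrite -!mulrA -!expRD addNr expR0 mulr1; apply: le_trans.
by rewrite mulrC (_ : 2 * y = y + y) //; ring.
Qed.

Lemma expR1_exp n : (0 < n)%N -> expR (n%:R^-1) ^+ n = e.
Proof. by move=> n0; rewrite -expRM_natl mulfV // pnatr_eq0 -lt0n. Qed.

(** [expR_atanh] at y = 1/(2(k+1)), where (1+y)/(1-y) = (2k+3)/(2k+1). *)
Lemma expR1_le_odd_ratio k : (2 * k%:R + 1) ^+ k.+1 * e <= (2 * k%:R + 3) ^+ k.+1 :> R.
Proof.
have k0 : 0 <= k%:R :> R by [].
rewrite -(@expR1_exp k.+1) // -exprMn lerXn2r ?nnegrE ?mulr_ge0 ?expR_ge0 //; try lra.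
have y0 : 0 <= (2 * (k%:R + 1))^-1 :> R by rewrite invr_ge0; lra.
have := expR_atanh y0.
have -> : 2 * (2 * (k%:R + 1))^-1 = k.+1%:R^-1 :> R.
  by rewrite -natr1; field; rewrite gt_eqF //; lra.
have p0 : 0 <= 2 * (k%:R + 1) :> R by lra.
set E := expR _; set Y := (2 * (k%:R + 1))^-1; move=> /(ler_wpM2l p0).
have YE : 2 * (k%:R + 1) * Y = 1 by rewrite mulfV // gt_eqF //; lra.
have -> : 2 * (k%:R + 1) * (E * (1 - Y)) = E * (2 * (k%:R + 1) - 2 * (k%:R + 1) * Y) by ring.
have -> : 2 * (k%:R + 1) * (1 + Y) = 2 * (k%:R + 1) + 2 * (k%:R + 1) * Y by ring.
by rewrite YE; lra.
Qed.

(** [expR_atanh] at y = 1/(2m+1), where (1+y)/(1-y) = (m+1)/m for m > 0. *)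
Lemma expR1_le_ratio m : m%:R ^+ (2 * m + 1) * e ^+ 2 <= m.+1%:R ^+ (2 * m + 1) :> R.
Proof.
have k0 : 0 <= m%:R :> R by [].
have y0 : 0 <= (2 * m%:R + 1)^-1 :> R by rewrite invr_ge0; lra.
have p0 : 0 < 2 * m%:R + 1 :> R by lra.
have -> : e ^+ 2 = expR (2 * (2 * m%:R + 1)^-1) ^+ (2 * m + 1).
  rewrite -!expRM_natl natrD natrM; congr expR; field; rewrite gt_eqF //.
rewrite -exprMn lerXn2r ?nnegrE ?mulr_ge0 ?expR_ge0 // -natr1.
have := expR_atanh y0; set E := expR _; set Y := (2 * m%:R + 1)^-1; move=> /(ler_wpM2l (ltW p0)).
have YE : (2 * m%:R + 1) * Y = 1 by rewrite mulfV // gt_eqF.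
have -> : (2 * m%:R + 1) * (E * (1 - Y)) = E * (2 * m%:R + 1 - (2 * m%:R + 1) * Y) by ring.
have -> : (2 * m%:R + 1) * (1 + Y) = 2 * m%:R + 1 + (2 * m%:R + 1) * Y by ring.
by rewrite YE; lra.
Qed.

Lemma succ_exp_le_expR1 m : m.+1%:R ^+ m <= e * m%:R ^+ m :> R.
Proof.
case: m => [|m]; first by rewrite !expr0 mulr1 -[X in X <= _]expR0 ler_expR.
rewrite -(@expR1_exp m.+1) // -exprMn lerXn2r ?nnegrE ?mulr_ge0 ?expR_ge0 //.
rewrite -[X in _ <= _ * X]invrK ler_pdivlMr ?invr_gt0 ?ltr0n //.
rewrite -natr1 mulrDl divff ?mul1r ?pnatr_eq0 //.
exact: expR_ge1Dx.
Qed.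

Lemma odd_fact_le k : odd_fact R k * e ^+ k <= (2 * k%:R + 1) ^+ k.
Proof.
elim: k => [|k IH]; first by rewrite /odd_fact big_ord0 mulr1.
have k0 : 0 <= k%:R :> R by [].
apply: le_trans (_ : (2 * k%:R + 1) ^+ k.+1 * e <= _); last first.
  apply: le_trans (expR1_le_odd_ratio k) _.
  by rewrite -(natr1 k) (_ : 2 * (k%:R + 1) + 1 = 2 * k%:R + 3) //; ring.
rewrite odd_factS !exprS.
have -> : odd_fact R k * (2 * k%:R + 1) * (e * e ^+ k)
  = (2 * k%:R + 1) * e * (odd_fact R k * e ^+ k) by ring.
rewrite [leRHS]mulrAC ler_wpM2l // mulr_ge0 ?expR_ge0 //; lra.
Qed.

(** The Stirling-type bound m! <= e sqrt(m) (m/e)^m, squared to remove the root. *)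
Lemma fact_sqr_le m : (0 < m)%N ->
  (m`!%:R * e ^+ m) ^+ 2 <= e ^+ 2 * m%:R * (m%:R ^+ m) ^+ 2 :> R.
Proof.
case: m => // m _; elim: m => [|m IH]; first by rewrite !expr1 expr1n !mulr1 mul1r.
have := ler_wpM2r (sqr_ge0 (m.+2%:R * e : R)) IH.
rewrite -exprMn (factS m.+1) natrM (exprS e m.+1) => H.
have -> : m.+2%:R * m.+1`!%:R * (e * e ^+ m.+1) = m.+1`!%:R * e ^+ m.+1 * (m.+2%:R * e) by ring.
apply: le_trans H _.
have := expR1_le_ratio m.+1.
rewrite exprD expr1 mulnC exprM [X in _ <= X -> _]exprD expr1 exprM => H.
have -> : e ^+ 2 * m.+1%:R * (m.+1%:R ^+ m.+1) ^+ 2 * (m.+2%:R * e) ^+ 2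
  = e ^+ 2 * m.+2%:R ^+ 2 * ((m.+1%:R ^+ m.+1) ^+ 2 * m.+1%:R * e ^+ 2) by ring.
have -> : e ^+ 2 * m.+2%:R * (m.+2%:R ^+ m.+2) ^+ 2
  = e ^+ 2 * m.+2%:R ^+ 2 * ((m.+2%:R ^+ m.+1) ^+ 2 * m.+2%:R) by rewrite [_ ^+ m.+2]exprS; ring.
by rewrite ler_wpM2l // mulr_ge0 ?sqr_ge0.
Qed.

(** The quotient j! e^j / j^j is nondecreasing in j, each step being (1 + 1/j)^j <= e. *)
Lemma fact_ratio_ge a m :
  a`!%:R * (a + m)%:R ^+ (a + m) <= (a + m)`!%:R * a%:R ^+ a * e ^+ m :> R.
Proof.
elim: m => [|m IH]; first by rewrite addn0 mulr1.
rewrite addnS factS natrM !exprS.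
have H := succ_exp_le_expR1 (a + m).
apply: le_trans (_ : (a + m).+1%:R * e * (a`!%:R * (a + m)%:R ^+ (a + m)) <= _).
  have -> : (a + m).+1%:R * e * (a`!%:R * (a + m)%:R ^+ (a + m))
   = a`!%:R * (a + m).+1%:R * (e * (a + m)%:R ^+ (a + m)) by ring.
  by rewrite mulrA ler_wpM2l // mulr_ge0.
have -> : (a + m).+1%:R * (a + m)`!%:R * a%:R ^+ a * (e * e ^+ m)
  = (a + m).+1%:R * e * ((a + m)`!%:R * a%:R ^+ a * e ^+ m) by ring.
by rewrite ler_wpM2l // mulr_ge0 ?expR_ge0.
Qed.

Lemma sqr_falling_fact n k : (k <= n)%N ->
  sqr_falling R n k * (n - k)`!%:R * (n%:R + k%:R) = n%:R * (n + k)`!%:R.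
Proof.
elim: k => [|k IH] kn; first by rewrite /sqr_falling big_ord0 subn0 addn0 addr0 mul1r mulrC.
have := IH (ltnW kn).
have -> : (n - k = (n - k.+1).+1)%N by rewrite subnSK.
rewrite factS natrM subnSK // natrB ?(ltnW kn) // addnS factS natrM sqr_fallingS -natr1 -(natr1
    (n + k)) natrD => E.
transitivity (sqr_falling R n k * ((n%:R - k%:R) * (n - k.+1)`!%:R) * (n%:R + k%:R) * (n%:R +
    k%:R + 1)).
  by ring.
by rewrite E; ring.
Qed.

Lemma odd_fact_sqr k : odd_fact R k ^+ 2 = wallis R k * (2 * k)`!%:R.
Proof.
elim: k => [|k IH]; first by rewrite /odd_fact /wallis !big_ord0 muln0 expr1n mulr1.
have k2 : 2 * k%:R + 2 != 0 :> R by rewrite gt_eqF // ltr_wpDl // mulr_ge0.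
rewrite odd_factS wallisS mulnS add2n !factS !natrM exprMn IH -(natr1 (2 * k).+1) -(natr1 (2 *
    k)) natrM.
by field.
Qed.

Lemma wallis_le_sqrt k : 2 * k%:R * wallis R k <= Num.sqrt 2 * Num.sqrt k%:R.
Proof.
have k0 : 0 <= k%:R :> R by [].
rewrite -sqrtrM // -[leLHS]ger0_norm ?mulr_ge0 ?wallis_ge0 // -sqrtr_sqr ler_wsqrtr //.
have := ler_wpM2l (mulr_ge0 (ler0n R 2) k0) (wallis_sqr_le R k).
by rewrite mulr1; apply: le_trans; have := sqr_ge0 (wallis R k); nra.
Qed.

Lemma wallis_sqr_bound k : 2 * k%:R * wallis R k ^+ 2 <= 1.
Proof.
apply: le_trans (wallis_sqr_le R k).
by rewrite mulrC ler_wpM2l ?sqr_ge0 // lerDl.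
Qed.

Lemma bernoulli x n : x <= 1 -> 1 - n%:R * x <= (1 - x) ^+ n.
Proof.
move=> x1; elim: n => [|n IH]; first by rewrite mul0r subr0.
rewrite exprS -(natr1 n).
have /ler_wpM2l /(_ _ _ IH) : 0 <= 1 - x by rewrite subr_ge0.
apply: le_trans; have := mulr_ge0 (ler0n R n) (sqr_ge0 x); nra.
Qed.

Lemma expR1_ge : 51 / 20 <= e.
Proof.
have /(lerXn2r 8) : 9 / 8 <= expR (8%:R^-1) :> R by apply: le_trans (expR_ge1Dx _); lra.
by rewrite !nnegrE expR_ge0 divr_ge0 // => /(_ isT isT); rewrite expR1_exp //; apply: le_trans; lra.
Qed.

Lemma expR1_lt4 : e < 4.
Proof.
rewrite -(@expR1_exp 2) //; set E := expR _.
have E0 : 0 < E by apply: expR_gt0.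
have := expRxMexpNx_1 (2^-1 : R); rewrite -/E.
have := expR_gt1Dx (_ : - 2^-1 != 0 :> R); rewrite oppr_eq0 invr_eq0 pnatr_eq0 => /(_ isT).
by nra.
Qed.

(** Since pi < 4, 2 sqrt(pi) <= 4. The numerical factors below are compared with e^2/4. *)
Lemma c1_sqr_ge : e ^+ 2 / 4 <= c1 R ^+ 2.
Proof.
have e0 : 0 <= e ^+ 2 by rewrite sqr_ge0.
have sp : 0 < Num.sqrt (pi : R) by rewrite sqrtr_gt0 pi_gt0.
rewrite /c1 sqr_sqrtr ?divr_ge0 ?mulr_ge0 ?(ltW sp) // ler_wpM2l // lef_pV2 ?posrE ?mulr_gt0 //.
have : Num.sqrt (pi : R) <= Num.sqrt (2 ^+ 2).
  by rewrite ler_wsqrtr //; have := pihalf_lt2 R; lra.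
by rewrite sqrtr_sqr ger0_norm //; lra.
Qed.
End Numerics.

(** * Bounds for the square of tau *)

Section Bounds.
Variable R : realType.
Implicit Types (n k m : nat) (w : R).
Local Notation e := (expR 1 : R).

Lemma expR1_gt0 : 0 < e. Proof. exact: expR_gt0. Qed.

Lemma sqr_falling_ge n k : (k <= n)%N ->
  (n%:R ^+ 2 - k%:R ^+ 2) ^+ k <= sqr_falling R n k.
Proof.
move=> kn; rewrite -[X in _ ^+ X]card_ord -prodr_const; apply: ler_prod => j _.
have kn2 : k%:R ^+ 2 <= n%:R ^+ 2 :> R by rewrite lerXn2r ?nnegrE // ler_nat.
by rewrite subr_ge0 kn2 /= lerD2l lerN2 ltW // ltr_sqr_nat.
Qed.

(** The base is the inverse of 1 - 1/(2k+1)^2, and Bernoulli gives 1 - k/(2k+1)^2 >= 8/9, sharp at k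
    = 1. *)
Lemma odd_ratio_exp_le k : (0 < k)%N ->
  ((2 * k%:R + 1) ^+ 2 / (4 * (k%:R * (k%:R + 1)))) ^+ k <= 9 / 8 :> R.
Proof.
move=> k0; have k1 : 1 <= k%:R :> R by rewrite ler1n.
have p0 : 0 < 4 * (k%:R * (k%:R + 1)) :> R by nra.
have q0 : 0 < (2 * k%:R + 1) ^+ 2 :> R by nra.
have x1 : (2 * k%:R + 1) ^- 2 <= 1 :> R by rewrite invf_le1 //; nra.
have := bernoulli k x1.
have -> : 1 - (2 * k%:R + 1) ^- 2 = ((2 * k%:R + 1) ^+ 2 / (4 * (k%:R * (k%:R + 1))))^-1 :> R.
  by field; rewrite !gt_eqF //; lra.
rewrite exprVn => H.
have {}H : 8 / 9 <= (((2 * k%:R + 1) ^+ 2 / (4 * (k%:R * (k%:R + 1)))) ^+ k)^-1 :> R.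
  apply: le_trans H; rewrite -subr_ge0.
  have -> : 1 - k%:R / (2 * k%:R + 1) ^+ 2 - 8 / 9
    = ((2 * k%:R + 1) ^+ 2 - 9 * k%:R) / (9 * (2 * k%:R + 1) ^+ 2) :> R.
    by field; rewrite gt_eqF //; lra.
  by rewrite divr_ge0 ?mulr_ge0 ?(ltW q0) //; nra.
have z0 : 0 < ((2 * k%:R + 1) ^+ 2 / (4 * (k%:R * (k%:R + 1)))) ^+ k :> R.
  by rewrite exprn_gt0 // divr_gt0.
rewrite -[leLHS]invrK -[leRHS]invrK lef_pV2 ?posrE ?invr_gt0 // ?divr_gt0 //.
by apply: le_trans H; rewrite invf_div.
Qed.

Lemma tau_sqr_le_small_k n k w : (0 < k)%N -> (k < n)%N -> is_omega n k w ->
  tau_at n k w ^+ 2 <= c1 R ^+ 2 * (2 / e) ^+ k ^+ 2 * Num.sqrt k%:R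
                       / (1 - k%:R ^+ 2 / n%:R ^+ 2) ^+ k.
Proof.
move=> k0 kn om; apply: le_trans (tau_sqr_le k0 kn om) _.
have kr : 0 < k%:R :> R by rewrite ltr0n.
have nr : 0 < n%:R :> R by rewrite ltr0n (leq_trans _ kn).
have e0 := expR1_gt0.
have kn2 : 0 < n%:R ^+ 2 - k%:R ^+ 2 :> R by rewrite subr_gt0 ltr_sqr_nat.
have kk : 0 < k%:R * (k%:R + 1) :> R by rewrite mulr_gt0 // addr_gt0.
have o0 := odd_fact_gt0 R k.
have h1 : odd_fact R k ^+ 2 <= ((2 * k%:R + 1) ^+ 2 / e ^+ 2) ^+ k.
  have : odd_fact R k <= ((2 * k%:R + 1) / e) ^+ k.
    by rewrite expr_div_n ler_pdivlMr ?exprn_gt0 // odd_fact_le.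
  move=> H; rewrite -expr_div_n -exprM mulnC exprM; apply: lerXn2r => //.
    by rewrite nnegrE ltW.
  by rewrite nnegrE exprn_ge0 // divr_ge0 ?(ltW e0) //; lra.
have h2 := wallis_le_sqrt R k.
have h3 : (sqr_falling R n k)^-1 <= ((n%:R ^+ 2 - k%:R ^+ 2) ^+ k)^-1.
  by rewrite lef_pV2 ?posrE ?exprn_gt0 ?sqr_falling_gt0 ?sqr_falling_ge // ltnW.
set u := (n%:R ^+ 2 / (k%:R * (k%:R + 1))) ^+ k.
have u0 : 0 <= u by rewrite exprn_ge0 // divr_ge0 ?sqr_ge0 // ltW.
apply: (@le_trans _ _ (((2 * k%:R + 1) ^+ 2 / e ^+ 2) ^+ k * (Num.sqrt 2 * Num.sqrt k%:R) * u
   * ((n%:R ^+ 2 - k%:R ^+ 2) ^+ k)^-1)).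
  have w0 : 0 <= 2 * k%:R * wallis R k by rewrite mulr_ge0 ?wallis_ge0 // mulr_ge0.
  have q0 : 0 <= (sqr_falling R n k)^-1 by rewrite invr_ge0 sqr_falling_ge0.
  apply: ler_pM => //; first by apply: mulr_ge0 => //; apply: mulr_ge0 => //; apply: sqr_ge0.
  by apply: ler_wpM2r => //; apply: ler_pM => //; apply: sqr_ge0.
have -> : ((2 * k%:R + 1) ^+ 2 / e ^+ 2) ^+ k * (Num.sqrt 2 * Num.sqrt k%:R) * u
   * ((n%:R ^+ 2 - k%:R ^+ 2) ^+ k)^-1
 = (Num.sqrt 2 * ((2 * k%:R + 1) ^+ 2 / (4 * (k%:R * (k%:R + 1)))) ^+ k) * ((2 / e) ^+ k ^+ 2 *
     Num.sqrt k%:R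
                       / (1 - k%:R ^+ 2 / n%:R ^+ 2) ^+ k).
  rewrite /u -[(2 / e) ^+ k ^+ 2]exprM mulnC exprM -[((_ - k%:R ^+ 2) ^+ k)^-1]exprVn -[((1 - _)
      ^+ k)^-1]exprVn.
  transitivity (Num.sqrt 2 * Num.sqrt k%:R * (((2 * k%:R + 1) ^+ 2 / e ^+ 2)
     * (n%:R ^+ 2 / (k%:R * (k%:R + 1))) * (n%:R ^+ 2 - k%:R ^+ 2)^-1) ^+ k).
    by rewrite [in RHS]exprMn [in RHS]exprMn; ring.
  transitivity (Num.sqrt 2 * Num.sqrt k%:R * (((2 * k%:R + 1) ^+ 2 / (4 * (k%:R * (k%:R + 1))))
     * (2 / e) ^+ 2 * (1 - k%:R ^+ 2 / n%:R ^+ 2)^-1) ^+ k); last first.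
    by rewrite [in LHS]exprMn [in LHS]exprMn; ring.
  by congr (_ * _ ^+ k); field; rewrite !gt_eqF //=; lra.
have -> : c1 R ^+ 2 * (2 / e) ^+ k ^+ 2 * Num.sqrt k%:R / (1 - k%:R ^+ 2 / n%:R ^+ 2) ^+ k
  = c1 R ^+ 2 * ((2 / e) ^+ k ^+ 2 * Num.sqrt k%:R / (1 - k%:R ^+ 2 / n%:R ^+ 2) ^+ k).
  by rewrite !mulrA.
apply: ler_wpM2r.
  rewrite !mulr_ge0 ?sqr_ge0 ?sqrtr_ge0 // invr_ge0 exprn_ge0 // subr_ge0.
  by rewrite ler_pdivrMr ?mul1r ?exprn_gt0 // -subr_ge0 ltW.
apply: le_trans (c1_sqr_ge R).
(* The constant left over is sqrt(2) times the power bounded by 9/8; 17/12 * 9/8 is below e^2/4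
   already for e >= 51/20. *)
have s2 : Num.sqrt 2 <= 17 / 12 :> R.
  rewrite -[leRHS]ger0_norm // -sqrtr_sqr ler_wsqrtr //; lra.
have z0 : 0 <= (2 * k%:R + 1) ^+ 2 / (4 * (k%:R * (k%:R + 1))) :> R.
  by apply: divr_ge0; [exact: sqr_ge0|apply: mulr_ge0 => //; exact: ltW].
apply: (@le_trans _ _ (17 / 12 * (9 / 8))).
  by apply: ler_pM; rewrite ?sqrtr_ge0 ?exprn_ge0 // odd_ratio_exp_le.
by have := expR1_ge R; nra.
Qed.

(** With k = n - m the bound is, up to a factor at most 2, (n/k)^(2k) m! (2k)!/(n+k)!. Of the powers
    e^m, those in the estimates of m! and of (2k)!/(n+k)! cancel, and the one from [r3] survives. *)
Lemma tau_sqr_le_small_m n m w : (0 < m)%N -> (m < n)%N -> is_omega n (n - m) w ->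
  tau_at n (n - m) w ^+ 2 <= 2 * e * Num.sqrt m%:R * (m%:R * e / (2 * n%:R)) ^+ m.
Proof.
move=> m0 mn; set k := (n - m)%N => om.
have k0 : (0 < k)%N by rewrite subn_gt0.
have kn : (k < n)%N by rewrite ltn_subrL m0 (leq_ltn_trans _ mn).
have nE : n = (k + m)%N by rewrite subnK // ltnW.
apply: le_trans (tau_sqr_le k0 kn om) _.
have kr : 0 < k%:R :> R by rewrite ltr0n.
have nr : 0 < n%:R :> R by rewrite ltr0n (leq_trans _ kn).
have e0 := expR1_gt0.
have kk : 0 < k%:R * (k%:R + 1) :> R by rewrite mulr_gt0 // addr_gt0.
have f0 j : 0 < j`!%:R :> R by rewrite ltr0n fact_gt0.
have QE : sqr_falling R n k = n%:R * (n + k)`!%:R / (m`!%:R * (n%:R + k%:R)).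
  have mE : (n - k = m)%N by rewrite nE addKn.
  rewrite -(sqr_falling_fact R (ltnW kn)) mE; field.
  by rewrite !gt_eqF // addr_gt0.
set u := (n%:R ^+ 2 / (k%:R * (k%:R + 1))) ^+ k.
have u0 : 0 <= u by rewrite exprn_ge0 // divr_ge0 ?sqr_ge0 // ltW.
have u1 : u <= (n%:R ^+ 2 / k%:R ^+ 2) ^+ k.
  rewrite lerXn2r ?nnegrE ?divr_ge0 ?sqr_ge0 ?(ltW kk) //.
  by rewrite ler_wpM2l ?sqr_ge0 // lef_pV2 ?posrE ?exprn_gt0 //; nra.
have N2k : (n + k = 2 * k + m)%N by rewrite {1}nE mul2n -addnn addnAC.
apply: (@le_trans _ _ (2 * ((n%:R ^+ 2 / k%:R ^+ 2) ^+ k * (m`!%:R * (2 * k)`!%:R / (n +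
    k)`!%:R)))).
  rewrite odd_fact_sqr QE.
  have -> : wallis R k * (2 * k)`!%:R * (2 * k%:R * wallis R k) * u
      / (n%:R * (n + k)`!%:R / (m`!%:R * (n%:R + k%:R)))
    = (2 * k%:R * wallis R k ^+ 2) * ((n%:R + k%:R) / n%:R) * (u * (m`!%:R * (2 * k)`!%:R / (n +
        k)`!%:R)).
    by field; rewrite !gt_eqF // addr_gt0.
  have g0 : 0 <= m`!%:R * (2 * k)`!%:R / (n + k)`!%:R :> R by rewrite divr_ge0 // mulr_ge0.
  have w0 : 0 <= 2 * k%:R * wallis R k ^+ 2 by rewrite mulr_ge0 ?sqr_ge0 // mulr_ge0.
  have d0 : 0 <= (n%:R + k%:R) / n%:R :> R by rewrite divr_ge0 // addr_ge0.
  have d2 : (n%:R + k%:R) / n%:R <= 2 :> R.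
    by rewrite ler_pdivrMr // mulr_natl mulr2n lerD2l ler_nat ltnW.
  apply: ler_pM; [exact: mulr_ge0|exact: mulr_ge0| |exact: ler_wpM2r].
  by rewrite -[leRHS]mul1r; apply: ler_pM => //; exact: wallis_sqr_bound.
have r1 : (2 * k)`!%:R / (n + k)`!%:R <= (2 * k)%:R ^+ (2 * k) * e ^+ m / (n + k)%:R ^+ (n + k)
    :> R.
  have N0 : 0 < (n + k)%:R ^+ (n + k) :> R by rewrite exprn_gt0 // ltr0n addn_gt0 k0 orbT.
  rewrite ler_pdivrMr // mulrAC ler_pdivlMr // N2k.
  by rewrite [leRHS]mulrC mulrA fact_ratio_ge.
have r2 : m`!%:R <= e * Num.sqrt m%:R * m%:R ^+ m / e ^+ m :> R.
  have em0 : 0 < e ^+ m by rewrite exprn_gt0.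
  rewrite ler_pdivlMr //.
  rewrite -ler_sqr ?nnegrE ?mulr_ge0 ?sqrtr_ge0 ?exprn_ge0 ?(ltW e0) //.
  by apply: le_trans (fact_sqr_le R m0) _; rewrite !exprMn sqr_sqrtr.
(* Because 2n = (n + k) + m, this is (1 + m/(n+k))^(n+k) <= e^m. *)
have r3 : (2 * n)%:R ^+ (n + k) <= e ^+ m * (n + k)%:R ^+ (n + k) :> R.
  have N0 : 0 < (n + k)%:R :> R by rewrite ltr0n addn_gt0 k0 orbT.
  have : (1 + m%:R / (n + k)%:R) ^+ (n + k) <= e ^+ m :> R.
    have -> : e ^+ m = expR (m%:R / (n + k)%:R) ^+ (n + k).
      by rewrite -!expRM_natl mulr1 mulrCA divff ?mulr1 // gt_eqF.
    by rewrite lerXn2r ?nnegrE ?expR_ge0 ?addr_ge0 ?divr_ge0 ?expR_ge1Dx // ltW.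
  have -> : 1 + m%:R / (n + k)%:R = (2 * n)%:R / (n + k)%:R :> R.
    have -> : (2 * n = (n + k) + m)%N by rewrite -addnA -nE mul2n addnn.
    by rewrite (natrD _ (n + k) m) mulrDl divff // gt_eqF.
  by rewrite expr_div_n ler_pdivrMr // exprn_gt0.
have N0 : 0 < (n + k)%:R ^+ (n + k) :> R by rewrite exprn_gt0 // ltr0n addn_gt0 k0 orbT.
have n2 : 0 < (2 * n)%:R ^+ m :> R by rewrite exprn_gt0 // ltr0n muln_gt0 (leq_ltn_trans _ mn).
have em0 : 0 < e ^+ m by rewrite exprn_gt0.
have r4 : (2 * n)%:R ^+ (2 * k) / (n + k)%:R ^+ (n + k) <= e ^+ m / (2 * n)%:R ^+ m :> R.
  by rewrite ler_pdivrMr // mulrAC ler_pdivlMr // -exprD -N2k.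
rewrite -(mulrA m`!%:R) -(mulrA 2 e) -(mulrA 2) ler_wpM2l //.
have r12 := ler_pM (ltW (f0 m)) (divr_ge0 (ltW (f0 _)) (ltW (f0 _))) r2 r1.
have A0 : 0 <= (n%:R ^+ 2 / k%:R ^+ 2) ^+ k :> R by rewrite exprn_ge0 // divr_ge0 ?sqr_ge0.
apply: le_trans (ler_wpM2l A0 r12) _.
have -> : (n%:R ^+ 2 / k%:R ^+ 2) ^+ k * (e * Num.sqrt m%:R * m%:R ^+ m / e ^+ m
    * ((2 * k)%:R ^+ (2 * k) * e ^+ m / (n + k)%:R ^+ (n + k)))
  = e * Num.sqrt m%:R * m%:R ^+ m * ((2 * n)%:R ^+ (2 * k) / (n + k)%:R ^+ (n + k)) :> R.
  have -> : (2 * n)%:R ^+ (2 * k) = (n%:R ^+ 2 / k%:R ^+ 2) ^+ k * (2 * k)%:R ^+ (2 * k) :> R.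
    rewrite !exprM -exprMn !natrM; congr (_ ^+ k); by field; rewrite gt_eqF.
  move: (_ ^+ k) ((2 * k)%:R ^+ _) (m%:R ^+ m) em0 N0 => A B C.
  move: (e ^+ m) ((n + k)%:R ^+ _) => E N E0 N0.
  by field; rewrite !gt_eqF.
have -> : e * Num.sqrt m%:R * (m%:R * e / (2 * n%:R)) ^+ m
  = e * Num.sqrt m%:R * m%:R ^+ m * (e ^+ m / (2 * n)%:R ^+ m) :> R.
  by rewrite !exprMn exprVn natrM; ring.
by rewrite ler_wpM2l // !mulr_ge0 ?exprn_ge0 ?sqrtr_ge0 // ltW.
Qed.

(** At n = 2k the bound of (i) has base 16/(3e^2) > 16/27, so the factorials are compared directly.
    The factor (k+1)/k is what lets the induction pass: 4(2k+1)^2 exceeds (16/9)(3k+1)(3k+2). The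
    constant 7/4 accommodates k = 2. *)
Lemma odd_fact_half_le k : (2 <= k)%N ->
  odd_fact R k ^+ 2 * k`!%:R * 4 ^+ k * (k%:R + 1)
  <= 7 / 4 * (16 / 27) ^+ k * (3 * k)`!%:R * k%:R.
Proof.
elim: k => // k IH; rewrite leq_eqVlt => /predU1P[[<-]|k2].
  have -> : (3 * 2)`!%:R = 720 :> R by [].
  have -> : 2`!%:R = 2 :> R by [].
  by rewrite /odd_fact !big_ord_recr big_ord0 /=; lra.
have k0 : 2 <= k%:R :> R by rewrite ler_nat.
have kp : 0 < k%:R :> R by lra.
have F0 : 0 < (3 * k)`!%:R :> R by rewrite ltr0n fact_gt0.
have c0 : 0 <= 4 * (2 * k%:R + 1) ^+ 2 * (k%:R + 2) :> R by nra.
have := ler_wpM2l c0 (IH k2).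
have -> : (3 * k.+1 = (3 * k).+3)%N by rewrite mulnS.
rewrite odd_factS factS [4 ^+ k.+1]exprS [(16 / 27) ^+ k.+1]exprS 3!(factS (3 * k)%N.+2, factS (3
    * k)%N.+1, factS (3 * k)%N).
rewrite !natrM -(natr1 (3 * k).+2) -(natr1 (3 * k).+1) -(natr1 (3 * k)) natrM -(natr1 k).
set O := odd_fact R k; set F := (3 * k)`!%:R; set G := k`!%:R; set P := 4 ^+ k; set Z := _ ^+ k.
have Z0 : 0 < Z by rewrite exprn_gt0.
set K : R := k%:R in kp k0 c0 *.
move=> H.
have H1 : 4 * (2 * K + 1) ^+ 2 * (K + 2) * (7 / 4 * Z * F * K)
   <= (7 / 4 * (16 / 27 * Z) * ((3 * K + 1 + 1 + 1) * ((3 * K + 1 + 1) * ((3 * K + 1) * F))) * (K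
       + 1)).
  rewrite -subr_ge0.
  have -> : 7 / 4 * (16 / 27 * Z) * ((3 * K + 1 + 1 + 1) * ((3 * K + 1 + 1) * ((3 * K + 1) * F)))
      * (K + 1)
    - 4 * (2 * K + 1) ^+ 2 * (K + 2) * (7 / 4 * Z * F * K)
   = 7 / 4 * Z * F * (48 * (3 * K + 1) * (3 * K + 2) * (K + 1) ^+ 2
        - 108 * (2 * K + 1) ^+ 2 * K * (K + 2)) / 27 by field.
  rewrite divr_ge0 // mulr_ge0 //; first by rewrite !mulr_ge0 // ltW.
  nra.
have := le_trans H H1.
have -> : (O * (2 * K + 1)) ^+ 2 * ((K + 1) * G) * (4 * P) * (K + 1 + 1)
  = 4 * (2 * K + 1) ^+ 2 * (K + 2) * (O ^+ 2 * G * P * (K + 1)) by ring.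
by [].
Qed.

Lemma ratio_exp_half k : (0 < k)%N -> (k%:R / (k%:R + 1)) ^+ k <= 2^-1 :> R.
Proof.
move=> k0; have kp : 0 < k%:R :> R by rewrite ltr0n.
have x1 : - k%:R^-1 <= 1 :> R by rewrite lerNl (le_trans (_ : _ <= 0)) ?invr_ge0 ?ltW // lerN10.
have := bernoulli k x1; rewrite opprK mulrN opprK divff ?gt_eqF // => H.
have -> : k%:R / (k%:R + 1) = (1 + k%:R^-1)^-1 :> R by field; rewrite !gt_eqF // addr_gt0.
have z : 0 < (1 + k%:R^-1) ^+ k :> R by rewrite exprn_gt0 // addr_gt0 // invr_gt0.
by rewrite exprVn lef_pV2 ?posrE.
Qed.

Lemma tau_sqr_lt_half k w : (2 <= k)%N -> is_omega (2 * k) k w ->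
  tau_at (2 * k) k w ^+ 2 < c1 R ^+ 2 * Num.sqrt (2 * k)%:R * (16 / 27) ^+ k.
Proof.
move=> k2 om; have k0 : (0 < k)%N by rewrite ltnW.
have kn : (k < 2 * k)%N by rewrite ltn_Pmull.
apply: le_lt_trans (tau_sqr_le k0 kn om) _.
have kr : 0 < k%:R :> R by rewrite ltr0n.
have F0 j : 0 < j`!%:R :> R by rewrite ltr0n fact_gt0.
have e0 := expR1_gt0.
have QE : sqr_falling R (2 * k) k = 2 / 3 * (3 * k)`!%:R / k`!%:R.
  have := sqr_falling_fact R (ltnW kn).
  have -> : (2 * k - k = k)%N by rewrite mul2n -addnn addnK.
  have -> : (2 * k + k = 3 * k)%N by rewrite -mulSnr.
  rewrite natrM => E.
  apply: (mulIf (_ : k`!%:R * (2 * k%:R + k%:R) != 0)).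
    by rewrite gt_eqF // mulr_gt0 // addr_gt0 // mulr_gt0.
  by rewrite mulrA E; field; rewrite gt_eqF.
have P0 : 0 < 4 ^+ k :> R by rewrite exprn_gt0.
have kk : 0 < k%:R + 1 :> R by rewrite addr_gt0.
have uE : ((2 * k)%:R ^+ 2 / (k%:R * (k%:R + 1))) ^+ k = 4 ^+ k * (k%:R / (k%:R + 1)) ^+ k :> R.
  by rewrite -exprMn natrM; congr (_ ^+ k); field; rewrite !gt_eqF.
rewrite uE QE.
set r := (k%:R / (k%:R + 1)) ^+ k.
have r2 : r <= 2^-1 by apply: ratio_exp_half.
have r0 : 0 <= r by rewrite exprn_ge0 // divr_ge0 // ltW.
have X : odd_fact R k ^+ 2 * k`!%:R * 4 ^+ k <= 7 / 4 * (16 / 27) ^+ k * (3 * k)`!%:R.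
  rewrite -(ler_pM2r kk); apply: le_trans (odd_fact_half_le k2) _.
  by rewrite ler_wpM2l ?lerDl // !mulr_ge0 // exprn_ge0.
set Z := (16 / 27) ^+ k in X *.
have Z0 : 0 < Z by rewrite exprn_gt0.
have s0 : 0 < Num.sqrt (2 * k)%:R :> R by rewrite sqrtr_gt0 ltr0n muln_gt0.
have W : 2 * k%:R * wallis R k <= Num.sqrt (2 * k)%:R.
  by rewrite natrM sqrtrM // wallis_le_sqrt.
have W0 : 0 <= 2 * k%:R * wallis R k by rewrite mulr_ge0 ?wallis_ge0 // mulr_ge0.
have -> : odd_fact R k ^+ 2 * (2 * k%:R * wallis R k) * (4 ^+ k * r) / (2 / 3 * (3 * k)`!%:R /
    k`!%:R)
  = 3 / 2 * (odd_fact R k ^+ 2 * k`!%:R * 4 ^+ k / (3 * k)`!%:R) * (2 * k%:R * wallis R k * r).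
  by field; rewrite !gt_eqF.
have Y : odd_fact R k ^+ 2 * k`!%:R * 4 ^+ k / (3 * k)`!%:R <= 7 / 4 * Z.
  by rewrite ler_pdivrMr.
have Y0 : 0 <= odd_fact R k ^+ 2 * k`!%:R * 4 ^+ k / (3 * k)`!%:R.
  apply: divr_ge0 => //; apply: mulr_ge0; last exact: ltW.
  by apply: mulr_ge0 => //; exact: sqr_ge0.
have V := ler_pM W0 r0 W r2.
have T := ler_pM Y0 (mulr_ge0 W0 r0) Y V.
(* The total constant is 3/2 * 7/4 * 1/2 = 21/16, strictly below e^2/4. *)
rewrite -mulrA; apply: le_lt_trans (ler_wpM2l (_ : 0 <= 3 / 2) T) _ => //.
have -> : 3 / 2 * (7 / 4 * Z * (Num.sqrt (2 * k)%:R * 2^-1))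
  = 21 / 16 * (Num.sqrt (2 * k)%:R * Z) by field.
rewrite -[ltRHS]mulrA ltr_pM2r ?mulr_gt0 //.
by apply: lt_le_trans (c1_sqr_ge R); have := expR1_ge R; nra.
Qed.

End Bounds.

(** * Real powers and comparison through squares *)

Section Powers.
Variable R : realType.
Implicit Types (x y : R) (n k : nat).
Local Notation e := (expR 1 : R).

Lemma le_of_sqr_le x y : 0 <= y -> x ^+ 2 <= y ^+ 2 -> x <= y.
Proof. by move=> y0 H; rewrite leNgt; apply/negP => yx; nra. Qed.

Lemma lt_of_sqr_lt x y : 0 <= y -> x ^+ 2 < y ^+ 2 -> x < y.
Proof. by move=> y0 H; rewrite ltNge; apply/negP => yx; nra. Qed.

Lemma powR_quarter_sqr x : 0 <= x -> powR x (1 / 4) ^+ 2 = Num.sqrt x.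
Proof.
move=> x0; rewrite -powR_mulrn ?powR_ge0 // -powRrM -powR12_sqrt //.
by congr powR; field.
Qed.

Lemma powR_half_sqr x n : 0 <= x -> powR x (n%:R / 2) ^+ 2 = x ^+ n.
Proof.
move=> x0; rewrite -powR_mulrn ?powR_ge0 // -powRrM -powR_mulrn //.
by congr powR; field.
Qed.

Lemma powR_lt1 x y : 0 <= x < 1 -> 0 < y -> powR x y < 1.
Proof.
move=> /andP[x0 x1] y0; have : powR x y < powR 1 y by rewrite gt0_ltr_powR // nnegrE.
by rewrite powR1.
Qed.

(** For 0 <= x <= 1/2 one has 1/(1-x) <= 1 + 2x <= e^(2x). *)
Lemma inv_exp_le_expR1 x n : 0 <= x -> x <= 2^-1 -> n%:R * x <= 1 ->
  ((1 - x) ^+ n)^-1 <= e ^+ 2.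
Proof.
move=> x0 x2 nx; have p : 0 < 1 - x by lra.
rewrite -exprVn; apply: (@le_trans _ _ (expR (2 * x) ^+ n)).
  rewrite lerXn2r ?nnegrE ?expR_ge0 ?invr_ge0 ?(ltW p) //.
  apply: le_trans (expR_ge1Dx _); rewrite -[leLHS]mul1r ler_pdivrMr //; nra.
by rewrite -!expRM_natl ler_expR; lra.
Qed.

End Powers.

Theorem theorem1p5 (R : realType) :
  exists c2 c3 c4 : R, [/\ 0 < c2, 0 < c3 & 0 < c4] /\
  [/\
   (* (i) *)
   (forall (n k : nat) (w : R), (1 <= k)%N -> (k + 2 <= n)%N -> is_omega n k w ->
      tau_at n k w <= c1 R * (2 / expR 1) ^+ k * powR (k%:R) (1/4)
                      / powR (1 - (k%:R ^+ 2 : R) / (n%:R ^+ 2)) (k%:R / 2)),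
   (forall (n k : nat) (w : R), (1 <= k)%N -> (k + 2 <= n)%N ->
      powR (k%:R : R) (3/2) <= n%:R -> is_omega n k w ->
      tau_at n k w < c2 * (2 / expR 1) ^+ k * powR (k%:R) (1/4)),
   (* (ii) *)
   (forall (m n : nat) (w : R), (2 <= m)%N -> (m + 1 <= n)%N -> is_omega n (n - m) w ->
      tau_at n (n - m) w <= c3 * powR (m%:R) (1/4)
        * powR (m%:R * expR 1 / 2) (m%:R / 2) * powR (n%:R) (- (m%:R / 2))),
   (* (iii) *)
   (forall lam : R, 0 < lam < 1 -> exists rho : R, 0 < rho < 1 /\
      forall (n : nat) (w : R), let k := Num.truncn (lam * n%:R) in
        (1 <= k)%N -> (k + 2 <= n)%N -> is_omega n k w ->
        tau_at n k w <= c4 * powR (n%:R) (1/4) * powR rho (n%:R / 2))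
   &
   (forall (n : nat) (w : R), ~~ odd n -> (4 <= n)%N -> is_omega n n./2 w ->
      tau_at n n./2 w < c1 R * powR (n%:R) (1/4) * powR (4 / Num.sqrt 27) (n%:R / 2))].
Proof.
have e0 : 0 < expR 1 :> R by apply: expR_gt0.
have eg := expR1_ge R; have el := expR1_lt4 R.
have c1p : 0 < c1 R.
  rewrite sqrtr_gt0 divr_gt0 ?exprn_gt0 // mulr_gt0 // sqrtr_gt0; exact: pi_gt0.
pose c3 : R := Num.sqrt (2 * expR 1).
have c3p : 0 < c3 by rewrite sqrtr_gt0 mulr_gt0.
have c3s : c3 ^+ 2 = 2 * expR 1 by rewrite sqr_sqrtr // mulr_ge0 // ltW.
have q0 k : 0 <= (2 / expR 1 : R) ^+ k by rewrite exprn_ge0 // divr_ge0 // ltW.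
have x01 n k : (k < n)%N -> 0 <= (k%:R ^+ 2 / n%:R ^+ 2 : R) < 1.
  move=> kn; have n2 : 0 < n%:R ^+ 2 :> R by rewrite exprn_gt0 // ltr0n (leq_trans _ kn).
  by rewrite divr_ge0 ?sqr_ge0 //= ltr_pdivrMr // mul1r ltr_sqr_nat.
(* In c2 the factor e is the root of the e^2 from [inv_exp_le_expR1] and the 2 makes the inequality
   strict; c3 = sqrt(2e) comes from [tau_sqr_le_small_m]; c4 dominates both cases of (iii). *)
exists (2 * c1 R * expR 1), c3, (c1 R + c3).
split; first by split=> //; rewrite ?mulr_gt0 ?addr_gt0.
split.
- move=> n k w k0 kn om; have {}kn : (k < n)%N by rewrite (leq_trans _ kn) // addn2 ltnW.
  have /andP[x0 x1] := x01 n k kn.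
  apply: le_of_sqr_le.
    by rewrite divr_ge0 ?powR_ge0 // !mulr_ge0 ?powR_ge0 // ltW.
  apply: le_trans (tau_sqr_le_small_k k0 kn om) _.
  by rewrite [leRHS]expr_div_n powR_half_sqr ?subr_ge0 ?(ltW x1) // [(_ * powR _ _) ^+ 2]exprMn
      [(c1 R * _) ^+ 2]exprMn powR_quarter_sqr.
- move=> n k w k0 kn2 pk om; have kn : (k < n)%N by rewrite (leq_trans _ kn2) // addn2 ltnW.
  have nr : 0 < n%:R :> R by rewrite ltr0n (leq_trans _ kn).
  have n2r : 0 < n%:R ^+ 2 :> R by rewrite exprn_gt0.
  have kr : 1 <= k%:R :> R by rewrite ler1n.
  have k3 : k%:R ^+ 3 <= n%:R ^+ 2 :> R.
    have := powR_half_sqr 3 (ler0n R k) => <-.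
    by rewrite lerXn2r ?nnegrE ?powR_ge0.
  (* For k >= 2 this follows from k^3 <= n^2; for k = 1 it needs n >= 3. *)
  have x2 : k%:R ^+ 2 / n%:R ^+ 2 <= 2^-1 :> R.
    rewrite ler_pdivrMr // mulrC ler_pdivlMr // mulrC.
    move: kn2; rewrite leq_eqVlt in k0; case/predU1P: k0 => [<-|k1] n3.
      have : 3 <= n%:R :> R by rewrite (ler_nat R 3).
      nra.
    have : 2 <= k%:R :> R by rewrite (ler_nat R 2).
    by move=> kr2; apply: le_trans k3; rewrite exprS; apply: ler_wpM2r; rewrite ?sqr_ge0.
  have kx : k%:R * (k%:R ^+ 2 / n%:R ^+ 2) <= 1 :> R.
    by rewrite mulrA -exprS ler_pdivrMr // mul1r.
  have /andP[x0 x1] := x01 n k kn.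
  have K0 : 0 < k%:R :> R by lra.
  have S0 : 0 < Num.sqrt k%:R :> R by rewrite sqrtr_gt0.
  have Q0 : 0 < (2 / expR 1 : R) ^+ k by rewrite exprn_gt0 // divr_gt0.
  apply: lt_of_sqr_lt; first by rewrite !mulr_ge0 ?powR_ge0 // ltW.
  apply: le_lt_trans (tau_sqr_le_small_k k0 kn om) _.
  rewrite [ltRHS]exprMn powR_quarter_sqr // [(_ * _ ^+ k) ^+ 2]exprMn.
  apply: le_lt_trans (ler_wpM2l _ (inv_exp_le_expR1 x0 x2 kx)) _.
    by rewrite !mulr_ge0 ?sqrtr_ge0 ?sqr_ge0.
  rewrite -subr_gt0.
  have -> : (2 * c1 R * expR 1) ^+ 2 * (2 / expR 1) ^+ k ^+ 2 * Num.sqrt k%:R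
     - c1 R ^+ 2 * (2 / expR 1) ^+ k ^+ 2 * Num.sqrt k%:R * expR 1 ^+ 2
   = 3 * (c1 R ^+ 2 * (2 / expR 1) ^+ k ^+ 2 * Num.sqrt k%:R * expR 1 ^+ 2) by ring.
  by rewrite mulr_gt0 // !mulr_gt0 ?exprn_gt0.
- move=> m n w m2 mn om; have {}mn : (m < n)%N by rewrite addn1 in mn.
  have nr : 0 < n%:R :> R by rewrite ltr0n (leq_trans _ mn).
  apply: le_of_sqr_le; first by rewrite !mulr_ge0 ?powR_ge0 // ltW.
  apply: le_trans (tau_sqr_le_small_m (ltnW m2) mn om) _.
  have b0 : 0 <= m%:R * expR 1 / 2 :> R by rewrite divr_ge0 // mulr_ge0 // ltW.
  rewrite powRN [leRHS]exprMn [(_ * powR (_ / 2) _) ^+ 2]exprMn [(c3 * _) ^+ 2]exprMn.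
  rewrite powR_quarter_sqr // powR_half_sqr // [(powR _ _)^-1 ^+ 2]exprVn powR_half_sqr // c3s.
  rewrite -[leRHS]mulrA -exprVn -[_ ^+ m * _]exprMn.
  have -> : m%:R * expR 1 / (2 * n%:R) = m%:R * expR 1 / 2 / n%:R :> R by field; rewrite gt_eqF.
  exact: lexx.
- move=> lam /andP[l0 l1].
  (* This is (2/e)^2 / (1 - 1/4), the base of the squared bound (i) at k = n/2; e/4 is the base
     me/(2n) of the squared bound (ii) at m = n/2. *)
  pose mu : R := 16 / (3 * expR 1 ^+ 2).
  have mu0 : 0 < mu by rewrite divr_gt0 // mulr_gt0 // exprn_gt0.
  have mu1 : mu < 1 by rewrite ltr_pdivrMr ?mulr_gt0 ?exprn_gt0 // mul1r; nra.
  have nu0 : 0 < expR 1 / 4 :> R by rewrite divr_gt0.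
  have nu1 : expR 1 / 4 < 1 :> R by rewrite ltr_pdivrMr // mul1r.
  (* The exponents come from k >= lam n/2, as lam n < k + 1 <= 2k, and from n - k >= (1 - lam) n. *)
  pose r1 := powR mu (lam / 2); pose r2 := powR (expR 1 / 4) (1 - lam).
  have r10 : 0 < r1 by rewrite powR_gt0.
  have r20 : 0 < r2 by rewrite powR_gt0.
  have r11 : r1 < 1 by rewrite powR_lt1 ?(ltW mu0) // divr_gt0.
  have r21 : r2 < 1 by rewrite powR_lt1 ?(ltW nu0) // subr_gt0.
  exists (Num.max r1 r2); split; first by rewrite lt_max r10 /= gt_max r11.
  move=> n w k k0 kn2 om; have {kn2} kn : (k < n)%N by rewrite (leq_trans _ kn2) // addn2 ltnW.
  have nr : 0 < n%:R :> R by rewrite ltr0n (leq_trans _ kn).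
  have ln0 : 0 <= lam * n%:R by rewrite mulr_ge0 // ltW.
  have /andP[kl kl1] := truncn_itv ln0; rewrite -/k -natr1 in kl kl1.
  have kr : 1 <= k%:R :> R by rewrite ler1n.
  have rho0 : 0 <= Num.max r1 r2 by rewrite le_max (ltW r10).
  apply: le_of_sqr_le; first by rewrite !mulr_ge0 ?powR_ge0 ?addr_ge0 // ltW.
  rewrite [leRHS]exprMn [((c1 R + c3) * _) ^+ 2]exprMn powR_quarter_sqr // powR_half_sqr //.
  have [k2|k2] := leqP (2 * k) n.
    apply: le_trans (tau_sqr_le_small_k k0 kn om) _.
    have /andP[x0 x1] := x01 n k kn.
    have kn2 : k%:R * 2 <= n%:R :> R by rewrite -natrM ler_nat mulnC.
    have x4 : k%:R ^+ 2 / n%:R ^+ 2 <= 4^-1 :> R.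
      rewrite ler_pdivrMr ?exprn_gt0 //; nra.
    have E1 : (2 / expR 1) ^+ k ^+ 2 / (1 - k%:R ^+ 2 / n%:R ^+ 2) ^+ k <= mu ^+ k :> R.
      rewrite -exprM mulnC exprM -expr_div_n lerXn2r ?nnegrE ?(ltW mu0) //.
        by rewrite divr_ge0 ?sqr_ge0 // subr_ge0 ltW.
      rewrite ler_pdivrMr ?subr_gt0 //.
      have -> : (2 / expR 1 : R) ^+ 2 = mu * (3 / 4) by rewrite /mu; field; rewrite gt_eqF.
      by rewrite ler_wpM2l ?(ltW mu0) //; lra.
    have E2 : mu ^+ k <= Num.max r1 r2 ^+ n.
      apply: (@le_trans _ _ (r1 ^+ n)); last first.
        by rewrite lerXn2r ?nnegrE ?(ltW r10) // le_max lexx.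
      rewrite -!powR_mulrn ?(ltW mu0) ?(ltW r10) // -powRrM ger_powR ?mu0 ?(ltW mu1) //.
      by lra.
    have -> : c1 R ^+ 2 * (2 / expR 1) ^+ k ^+ 2 * Num.sqrt k%:R / (1 - k%:R ^+ 2 / n%:R ^+ 2) ^+ k
      = c1 R ^+ 2 * Num.sqrt k%:R * ((2 / expR 1) ^+ k ^+ 2 / (1 - k%:R ^+ 2 / n%:R ^+ 2) ^+ k).
      by ring.
    apply: ler_pM.
    - by rewrite mulr_ge0 ?sqr_ge0 ?sqrtr_ge0.
    - by rewrite divr_ge0 ?sqr_ge0 // exprn_ge0 // subr_ge0 ltW.
    - apply: ler_pM; rewrite ?sqr_ge0 ?sqrtr_ge0 //; first by nra.
      by rewrite ler_wsqrtr // ler_nat ltnW.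
    - exact: le_trans E2.
  have mE : k = (n - (n - k))%N by rewrite subKn // ltnW.
  have m0 : (0 < n - k)%N by rewrite subn_gt0.
  have mn : (n - k < n)%N by rewrite ltn_subrL k0 (leq_trans _ kn).
  have kn2 : n%:R <= k%:R * 2 :> R by rewrite -natrM ler_nat mulnC ltnW.
  have := tau_sqr_le_small_m m0 mn; rewrite -mE => /(_ R w om) H.
  apply: le_trans H _; rewrite natrB ?(ltnW kn) //.
  have mp : 0 < n%:R - k%:R :> R by rewrite subr_gt0 ltr_nat.
  have E1 : ((n%:R - k%:R) * expR 1 / (2 * n%:R)) ^+ (n - k) <= (expR 1 / 4 : R) ^+ (n - k).
    rewrite lerXn2r ?nnegrE ?(ltW nu0) //.
      by rewrite divr_ge0 ?mulr_ge0 // ltW.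
    rewrite ler_pdivrMr ?mulr_gt0 // mulrC -mulrA ler_wpM2l ?(ltW e0) //; lra.
  have E2 : (expR 1 / 4 : R) ^+ (n - k) <= Num.max r1 r2 ^+ n.
    apply: (@le_trans _ _ (r2 ^+ n)); last first.
      by rewrite lerXn2r ?nnegrE ?(ltW r20) // le_max lexx orbT.
    rewrite -!powR_mulrn ?(ltW nu0) ?(ltW r20) // -powRrM ger_powR ?nu0 ?(ltW nu1) //.
    by rewrite natrB ?(ltnW kn) //; lra.
  apply: ler_pM.
  - by rewrite mulr_ge0 ?sqrtr_ge0 // mulr_ge0 // ltW.
  - by rewrite exprn_ge0 // divr_ge0 // mulr_ge0 // ltW.
  - rewrite -c3s; apply: ler_pM; rewrite ?sqr_ge0 ?sqrtr_ge0 //; first by nra.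
    by rewrite ler_wsqrtr // gerBl.
  - exact: le_trans E2.
- move=> n w en n4; have [k nE] : exists k, n = (2 * k)%N.
    by exists n./2; rewrite mul2n halfK (negPf en) subn0.
  rewrite nE in n4 *; rewrite mul2n doubleK -mul2n => om.
  have k2 : (2 <= k)%N by rewrite -(leq_pmul2l (_ : 0 < 2)%N).
  have s27 : 0 <= 4 / Num.sqrt 27 :> R by rewrite divr_ge0 ?sqrtr_ge0.
  apply: lt_of_sqr_lt; first by rewrite !mulr_ge0 ?powR_ge0 // ltW.
  apply: lt_le_trans (tau_sqr_lt_half k2 om) _.
  rewrite [leRHS]exprMn [(c1 R * _) ^+ 2]exprMn powR_quarter_sqr // powR_half_sqr //.
  have q27 : (4 / Num.sqrt 27) ^+ 2 = 16 / 27 :> R.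
    by rewrite expr_div_n sqr_sqrtr // -natrX.
  by rewrite [(_ / _) ^+ (2 * k)]exprM q27.
Qed.
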